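(* Let $K$ be a field such that for every finite field extension $L$ of $K$ and every natural number $n>0$ the index $[L^*:(L^* )^n]$ is finite, and, if $\operatorname{char}(K)=p>0$, then for every finite extension $L$ of $K$, with $f\colon L\to L$ given by $f(x)=x^p-x$, the index $[L^+:f[L]]$ is also finite. Then either there is a non-trivial definable valuation on $K$, or every non-trivial valuation on $K$ has divisible value group and, in the case $\operatorname{char}(K)>0$, has algebraically closed residue field.
   Context: $L^*$ denotes the multiplicative group, $(L^* )^n$ its subgroup of $n$-th powers, and $L^+$ the additive group of $L$. A valuation $v$ on $K$ with valuation ring $\mathcal{O}_v=\{x: v(x)\ge 0\}$ is non-trivial if $\mathcal{O}_v\neq K$; it is definable if $\mathcal{O}_v$ is a definable subset of $K$ (first-order definable, with parameters, in the field $K$). The residue field is $\mathcal{O}_v/\mathcal{M}_v$ where $\mathcal{M}_v=\{x:v(x)>0\}$. *)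

(* Defs.v *)
From HB Require Import structures.
From mathcomp Require Import all_boot all_order all_algebra all_field.

Set Implicit Arguments.
Unset Strict Implicit.
Unset Printing Implicit Defensive.

Import Order.TTheory GRing.Theory Num.Theory.
Local Open Scope ring_scope.
Local Open Scope quotient_scope.

(* [G : H] < oo for subgroups H <= G of a group with law op: finitely many     *)
(* left cosets a H, with a in G, cover G.                                      *)
Definition finite_index (T : eqType) (op : T -> T -> T) (G H : T -> Prop) :=
  exists s : seq T, (forall a, a \in s -> G a) /\
    forall g, G g -> exists2 a, a \in s & exists2 h, H h & g = op a h.

Definition mult_group (L : fieldType) (x : L) : Prop := x != 0.

Definition mult_powers (L : fieldType) (n : nat) (x : L) : Prop :=
  exists2 y, mult_group y & x = y ^+ n.

Definition add_group (L : fieldType) (x : L) : Prop := True.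

Definition artin_schreier_image (L : fieldType) (p : nat) (z : L) : Prop :=
  exists x, z = x ^+ p - x.

(* The constants occurring in f are the parameters, and x is the value of      *)
(* 'X_0; any other free variable of f is read as the parameter 0. The          *)
(* inverse and unit symbols of GRing.formula are definable in the language of  *)
(* rings, hence they do not enlarge the class of definable sets.               *)
Definition definable (K : fieldType) (A : {pred K}) : Prop :=
  exists f : GRing.formula K, forall x, x \in A <-> GRing.holds [:: x] f.

Section OrderedGroup.
Variable Gamma : porderZmodType.

(* porderZmodType does not relate the order to the addition.                   *)
Definition totally_ordered_group : Prop :=
  total (<=%R : rel Gamma) /\
  (forall c a b : Gamma, a <= b -> c + a <= c + b).

(* Operations on Gamma with a point at infinity, which is None.                *)
Definition eadd (a b : option Gamma) : option Gamma :=
  match a, b with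
  | Some a', Some b' => Some (a' + b')
  | _, _ => None
  end.

Definition ele (a b : option Gamma) : bool :=
  match a, b with
  | _, None => true
  | None, Some _ => false
  | Some a', Some b' => a' <= b'
  end.

Definition elt (a b : option Gamma) : bool := ele a b && (a != b).

Definition emin (a b : option Gamma) : option Gamma :=
  if ele a b then a else b.

End OrderedGroup.

(* A Krull valuation of arbitrary rank, written additively. It need not be     *)
(* onto Gamma: the value group is the image of K^*.                            *)
Record valuation (K : fieldType) := Valuation {
  val_codom : porderZmodType;
  val_fun :> K -> option val_codom;
  val_codom_ordered : totally_ordered_group val_codom;
  val_infty : forall x, (val_fun x == None) = (x == 0);
  val_mul : forall x y, val_fun (x * y) = eadd (val_fun x) (val_fun y);
  val_add : forall x y, ele (emin (val_fun x) (val_fun y)) (val_fun (x + y))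
}.

Section Valuation.
Variables (K : fieldType) (v : valuation K).

Definition val_ring : {pred K} := [pred x | ele (Some 0) (v x)].
Definition val_ideal : {pred K} := [pred x | elt (Some 0) (v x)].

Definition nontrivial_valuation : Prop := ~ (forall x, x \in val_ring).

Definition value_group (g : val_codom v) : Prop :=
  exists2 x, x != 0 & v x = Some g.

Definition divisible_value_group : Prop :=
  forall n : nat, (0 < n)%N -> forall g, value_group g ->
    exists2 h, value_group h & h *+ n = g.

Local Notation Gamma := (val_codom v).

Let vtot : total (<=%R : rel Gamma) := (val_codom_ordered v).1.
Let vleD := (val_codom_ordered v).2.

Lemma val0 : v 0 = None.
Proof. by apply/eqP; rewrite (val_infty v) eqxx. Qed.

Lemma val_nz x : x != 0 -> exists g, v x = Some g.
Proof. by rewrite -(val_infty v); case: (v x) => // g _; exists g. Qed.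

Lemma val1 : v 1 = Some 0.
Proof.
have [g Eg] := val_nz (oner_neq0 K).
have := val_mul v 1 1; rewrite mulr1 Eg /= => -[] /esym/eqP.
by rewrite -subr_eq0 addrK => /eqP->.
Qed.

Lemma valN1 : v (-1) = Some 0.
Proof.
have [|g Eg] := @val_nz (-1); first by rewrite oppr_eq0 oner_neq0.
have := val_mul v (-1) (-1); rewrite mulrNN mulr1 val1 Eg /= => -[] g2.
congr Some; apply: le_anti.
case/orP: (vtot g 0) => gle; rewrite gle ?andbT /=;
  by have := vleD g gle; rewrite addr0 -g2.
Qed.

Lemma valN x : v (- x) = v x.
Proof. by rewrite -mulN1r val_mul valN1; case: (v x) => //= a; rewrite add0r. Qed.

Lemma val_ring1 : 1 \in val_ring.
Proof. by rewrite inE val1 /=. Qed.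

Lemma ele_trans (a b c : option Gamma) : ele a b -> ele b c -> ele a c.
Proof. by move: a b c => [a|] [b|] [c|] //=; apply: le_trans. Qed.

Lemma elt0E (a : option Gamma) : elt (Some 0) a = ~~ ele a (Some 0).
Proof.
rewrite /elt; case: a => [a|] //=; rewrite (inj_eq Some_inj).
apply/andP/idP => [[a0 nz]|na].
  by apply: contra nz => a0'; rewrite eq_le a0 a0'.
split; first by have := vtot a 0; rewrite (negPf na).
by apply: contra na => /eqP<-.
Qed.

Lemma val_ring_subring : subring_closed val_ring.
Proof.
split=> [|x y|x y]; rewrite ?val_ring1 // !inE => vx vy.
  apply: ele_trans (val_add v x (- y)); rewrite valN /emin.
  by case: ifP.
rewrite val_mul; move: (v x) (v y) vx vy => [a|] [b|] //= a0 b0.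
by apply: (le_trans a0); have := vleD a b0; rewrite addr0.
Qed.
HB.instance Definition _ := GRing.isSubringClosed.Build K val_ring val_ring_subring.

Record val_ring_type := ValRing {
  val_ring_elt :> K;
  _ : val_ring_elt \in val_ring
}.
HB.instance Definition _ := [isSub for val_ring_elt].
HB.instance Definition _ := [Choice of val_ring_type by <:].
HB.instance Definition _ := [SubChoice_isSubComNzRing of val_ring_type by <:].

Definition val_max_ideal : {pred val_ring_type} :=
  fun x => (val x : K) \in val_ideal.

Lemma val_max_idealE x :
  (x \in val_max_ideal) = ~~ ele (v (val x)) (Some 0).
Proof. by rewrite -elt0E. Qed.

Lemma val_max_idealP : idealr_closed val_max_ideal.
Proof.
split=> [||a x y]; rewrite !val_max_idealE /= ?val0 ?val1 /= ?lexx //.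
case: a x y => [a aP] [x xP] [y yP] /=; move: aP; rewrite inE.
move=> va vx vy; have vax : ~~ ele (v (a * x)) (Some 0).
  rewrite val_mul; move: (v a) (v x) va vx => [b|] [c|] //= b0; apply: contra.
  by apply: le_trans; have := vleD c b0; rewrite addr0 addrC.
apply/negP => le0; have := ele_trans (val_add v (a * x) y) le0.
by rewrite /emin; case: ifP => _; apply/negP.
Qed.
HB.instance Definition _ :=
  isIdealr.Build val_ring_type val_max_ideal val_max_idealP.

Definition residue_field : Type := {ideal_quot val_max_ideal}.
HB.instance Definition _ := GRing.ComNzRing.on residue_field.

Lemma val_ring_inv x : x \in val_ring -> x \notin val_ideal -> x^-1 \in val_ring.
Proof.
rewrite !inE elt0E negbK => x0 x0'.
have nz : x != 0 by apply: contraTneq x0' => ->; rewrite val0.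
have [a Ea] := val_nz nz.
have [|b Eb] := @val_nz x^-1; first by rewrite invr_eq0.
have := val_mul v x x^-1; rewrite divff // val1 Ea Eb /= => -[] ab.
move: x0'; rewrite Ea /= => a0'.
by have := vleD b a0'; rewrite addr0 addrC -ab.
Qed.

Definition residue_inv (x : residue_field) : residue_field :=
  if x == 0 then 0
  else \pi_residue_field (insubd (0 : val_ring_type) (val (repr x))^-1).

Lemma residue_mulVf x : x != 0 -> residue_inv x * x = 1.
Proof.
move=> xnz; rewrite /residue_inv (negPf xnz).
have rP : repr x \notin val_max_ideal.
  by rewrite -[repr x]subr0 Quotient.idealrBE reprK pi_zeror.
have rnz : val (repr x) != 0.
  by apply: contraNneq rP => r0; rewrite val_max_idealE r0 val0.
rewrite -[x in _ * x]reprK -pi_mulr -pi_oner; congr \pi.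
apply: val_inj; rewrite rmorphM rmorph1 /= insubdK ?mulVf //.
by apply: val_ring_inv => //; apply: valP.
Qed.

Lemma residue_inv0 : residue_inv 0 = 0.
Proof. by rewrite /residue_inv eqxx. Qed.

HB.instance Definition _ :=
  GRing.ComNzRing_isField.Build residue_field residue_mulVf residue_inv0.

End Valuation.

(* Main.v *)
(* Let [S] be a subgroup of finite index in [L^x] that contains the [n]-th     *)
(* powers; it is a finite union of their cosets, hence definable. If [S] is    *)
(* proper and contains the units of a valuation ring [O], then the set of [x]  *)
(* such that multiplication by [x] maps the part of the maximal ideal lying    *)
(* outside [S] into the maximal ideal is a valuation ring, and it is definable *)
(* because, outside [S], [x] is in the maximal ideal iff [1 + x] is in [S].    *)
(* With [S = O^x (K^x)^n] this settles the value group.                        *)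
(*                                                                             *)
(* In characteristic [p], suppose that the residue field [k] of [v] is not     *)
(* algebraically closed. As [k] is perfect, by Kummer and Artin-Schreier       *)
(* theory some [b] in a finite extension of [k] is not a [q]-th power, or not  *)
(* of the form [c ^+ p - c], in [k(b)]. Lifting the minimal polynomial of [b]  *)
(* yields a finite extension [L] of [K] with a valuation ring of residue field *)
(* [k(b)] and maximal ideal [M], and [G = (L^x)^q (1 + M)], resp.              *)
(* [A = {y ^+ p - y} + M], is a proper definable subgroup. Replace the         *)
(* valuation ring by a minimal one [O] with [1 + M <= G], resp. [M <= A]. Up   *)
(* to the case of the first paragraph and its additive analogue, there is a    *)
(* definable [U] with [M <= U <= O], and [M] is then the definable set of all  *)
(* [c] such that the neighbourhoods [c U] satisfy the axioms of a V-topology:  *)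
(* a unit [c] of this kind would turn the elements with bounded [p ^ j]-th     *)
(* powers into a valuation ring contradicting the minimality of [O].           *)

From HB Require Import structures.
Require Import Defs.
From mathcomp Require Import all_boot all_order all_algebra all_field all_fingroup all_solvable.
From mathcomp Require Import boolp classical_sets ring zify.

Set Implicit Arguments.
Unset Strict Implicit.
Unset Printing Implicit Defensive.

Import Order.TTheory GRing.Theory Num.Theory.
Local Open Scope ring_scope.
Local Open Scope quotient_scope.

(** * Valuation rings *)

(** A failure of the second alternative is turned into a proper definable valuation ring of some
    finite extension [L] of [K]. This suffices: [L] is interpreted in [K] by coordinates, and the
    ring meets [K] in a proper subring, [L] being integral over [K] ([definable_valring_restrict]).

    Such rings arise in two ways from a proper definable subgroup. Either the subgroup alone
    describes a coarsening ([unit_group_valring], [transporter_valring]), or the maximal ideal of a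
    minimal valuation ring is recognised from a definable set between the ideal and the ring
    ([conductor_vmax]). The second way relies on Frobenius being additive and on the subgroups being
    closed under [p]-th roots.

    If no [L] has a definable ring, [residue_radical] and [residue_artin_schreier] extract roots in
    residue fields. By [unramified_lift] they reach every element of every finite extension of the
    residue field of [v], and [closed_of_radicals] concludes by Galois theory. *)

Definition valring (L : fieldType) (O : L -> Prop) : Prop :=
  [/\ O 1, forall x y, O x -> O y -> O (x - y),
      forall x y, O x -> O y -> O (x * y) & forall x, O x \/ O x^-1].

Definition vmax (L : fieldType) (O : L -> Prop) (x : L) : Prop :=
  x = 0 \/ ~ O x^-1.

Section ValuationRing.
Context (L : fieldType) (O : L -> Prop) (vO : valring O).
Local Notation M := (vmax O).
Implicit Types x y : L.

Lemma vr1 : O 1. Proof. by case: vO. Qed.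
Lemma vrB x y : O x -> O y -> O (x - y). Proof. by case: vO => _ + _ _; apply. Qed.
Lemma vrM x y : O x -> O y -> O (x * y). Proof. by case: vO => _ _ + _; apply. Qed.
Lemma vr_total x : O x \/ O x^-1. Proof. by case: vO. Qed.
Lemma vr0 : O 0. Proof. by rewrite -(subrr 1); apply: vrB vr1 vr1. Qed.
Lemma vrN x : O x -> O (- x).
Proof. by move=> Ox; rewrite -sub0r; apply: vrB vr0 Ox. Qed.
Lemma vrD x y : O x -> O y -> O (x + y).
Proof. by move=> Ox Oy; rewrite -[y]opprK; apply: vrB => //; apply: vrN. Qed.
Lemma vrX x n : O x -> O (x ^+ n).
Proof.
by move=> Ox; elim: n => [|n IH]; rewrite ?expr0 ?exprS; [apply: vr1 | apply: vrM].
Qed.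

Lemma vmaxV x : ~ O x -> M x^-1.
Proof. by move=> nOx; right; rewrite invrK. Qed.

Lemma vmax_sub x : M x -> O x.
Proof. by case=> [->|nO]; [apply: vr0 | case: (vr_total x)]. Qed.

Lemma vmax1 : ~ M 1.
Proof. by case=> [/eqP|]; [rewrite oner_eq0 | rewrite invr1 => /(_ vr1)]. Qed.

Lemma vrV x : ~ M x -> O x^-1.
Proof. by move=> nM; apply: contrapT => nO; apply: nM; right. Qed.

Lemma vmaxMl x y : O x -> M y -> M (x * y).
Proof.
move=> Ox [->|nO]; first by rewrite mulr0; left.
have [->|x0] := eqVneq x 0; first by rewrite mul0r; left.
right=> Oxy; apply: nO; suff -> : y^-1 = x * (x * y)^-1 by apply: vrM.
by rewrite invfM mulrA divff // mul1r.
Qed.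

Lemma vmaxMr x y : M x -> O y -> M (x * y).
Proof. by move=> Mx Oy; rewrite mulrC; apply: vmaxMl. Qed.

Lemma vmaxN x : M x -> M (- x).
Proof. by move=> Mx; rewrite -mulN1r; apply: vmaxMl => //; apply: vrN vr1. Qed.

Lemma vmaxD x y : M x -> M y -> M (x + y).
Proof.
move=> Mx My.
have [->|x0] := eqVneq x 0; first by rewrite add0r.
have [->|y0] := eqVneq y 0; first by rewrite addr0.
have [Oq|Oq] := vr_total (x / y).
  rewrite (_ : x + y = (x / y + 1) * y); last by rewrite mulrDl divfK // mul1r.
  by apply: vmaxMl => //; apply: vrD => //; apply: vr1.
rewrite (_ : x + y = ((x / y)^-1 + 1) * x); last first.
  by rewrite invf_div mulrDl divfK // mul1r addrC.
by apply: vmaxMl => //; apply: vrD => //; apply: vr1.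
Qed.

Lemma vmaxB x y : M x -> M y -> M (x - y).
Proof. by move=> Mx My; apply: vmaxD => //; apply: vmaxN. Qed.

Lemma vmax_1D m : M m -> 1 + m != 0 /\ ~ M (1 + m).
Proof.
move=> Mm; have nM : ~ M (1 + m).
  by move=> /vmaxB /(_ Mm); rewrite addrK; apply: vmax1.
by split=> //; apply/eqP => e0; apply: nM; rewrite e0; left.
Qed.

Lemma vmaxX x n : M x -> M (x ^+ n.+1).
Proof. by move=> Mx; rewrite exprS; apply: vmaxMr => //; apply: vrX (vmax_sub Mx). Qed.

Lemma vr_root x n : O (x ^+ n.+1) -> O x.
Proof.
move=> Ox; apply: contrapT => nOx; have Mx := vmaxV nOx.
have x0 : x != 0 by apply/eqP => x0; apply: nOx; rewrite x0; apply: vr0.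
apply: vmax1; rewrite -(divff (expf_neq0 n.+1 x0)) -exprVn.
by apply: vmaxMl Ox _; apply: vmaxX.
Qed.

End ValuationRing.

(** * The valuation of a valuation ring *)

(* The value group is the quotient of [K] that identifies [0] with [1] and,    *)
(* outside [0], elements differing by a unit of the valuation ring.            *)
Section ValueGroup.
Context (K : fieldType) (O : K -> Prop) (vO : valring O).

Let nz (x : K) := if x == 0 then 1 else x.

Let nz_neq0 x : nz x != 0.
Proof. by rewrite /nz; case: (eqVneq x 0) => // _; apply: oner_neq0. Qed.

Let nzE x : x != 0 -> nz x = x. Proof. by rewrite /nz => /negPf->. Qed.

Let vle (x y : K) := `[< O (nz y / nz x) >].

Let vle_refl x : vle x x.
Proof. by apply/asboolP; rewrite divff //; apply: (vr1 vO). Qed.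

Let vle_trans y x z : vle x y -> vle y z -> vle x z.
Proof.
move=> /asboolP xy /asboolP yz; apply/asboolP.
by have := vrM vO yz xy; rewrite mulrA divfK.
Qed.

Let vle_total x y : vle x y || vle y x.
Proof.
apply/orP; have [H|H] := vr_total vO (nz y / nz x); first by left; apply/asboolP.
by right; apply/asboolP; rewrite -invf_div.
Qed.

Let vle_mul z x y : vle x y -> vle (nz z * nz x) (nz z * nz y).
Proof.
move=> /asboolP H; apply/asboolP.
have E w : nz (nz z * nz w) = nz z * nz w by rewrite nzE // mulf_neq0.
by rewrite !E -mulf_div divff // mul1r.
Qed.

Let veq x y := vle x y && vle y x.

Fact veq_equiv : equiv_class_of veq.
Proof.
split=> [x|x y|y x z]; rewrite /veq ?vle_refl //; first exact: andbC.
move=> /andP[xy yx] /andP[yz zy]; apply/andP.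
by split; [apply: vle_trans xy yz | apply: vle_trans zy yx].
Qed.

Canonical veq_equiv_rel := EquivRelPack veq_equiv.

Definition value_quot := {eq_quot veq}.
HB.instance Definition _ := EqQuotient.on value_quot.
HB.instance Definition _ := Choice.on value_quot.

Let vclass (x : K) : value_quot := \pi_value_quot x.

Let vclassP x y : reflect (vclass x = vclass y) (veq x y).
Proof. exact: eqquotP. Qed.

Let vclass_repr a : vclass (generic_quotient.repr a) = a. Proof. exact: reprK. Qed.

Let vclass_nz x : vclass (nz x) = vclass x.
Proof.
apply/vclassP/andP; split; apply/asboolP; rewrite (nzE (nz_neq0 x)) divff //.
  exact: vr1 vO.
exact: vr1 vO.
Qed.

Let vclassW (P : value_quot -> Prop) :
  (forall x, x != 0 -> P (vclass x)) -> forall a, P a.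
Proof. by move=> H a; rewrite -[a]vclass_repr -vclass_nz; apply: H. Qed.

Definition vadd (a b : value_quot) := vclass (nz (generic_quotient.repr a) * nz (generic_quotient.repr b)).
Definition vopp (a : value_quot) := vclass (nz (generic_quotient.repr a))^-1.
Definition vqle (a b : value_quot) := vle (generic_quotient.repr a) (generic_quotient.repr b).

Let repr_vclass x : vle x (generic_quotient.repr (vclass x)) /\ vle (generic_quotient.repr (vclass x)) x.
Proof. by apply/andP/(vclassP x); rewrite vclass_repr. Qed.

Let vaddE x y : x != 0 -> y != 0 -> vadd (vclass x) (vclass y) = vclass (x * y).
Proof.
move=> x0 y0; apply/vclassP; have [x1 x2] := repr_vclass x; have [y1 y2] := repr_vclass y.
have -> : x * y = nz x * nz y by rewrite !nzE.
apply/andP; split.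
  by apply: vle_trans (vle_mul _ y2) _; rewrite ![_ * nz y]mulrC; apply: vle_mul.
by apply: vle_trans (vle_mul _ y1) _; rewrite ![_ * nz (generic_quotient.repr (vclass y))]mulrC; apply: vle_mul.
Qed.

Let vqleE x y : vqle (vclass x) (vclass y) = vle x y.
Proof.
have [x1 x2] := repr_vclass x; have [y1 y2] := repr_vclass y.
apply/idP/idP => H; first exact: vle_trans x1 (vle_trans H y2).
exact: vle_trans x2 (vle_trans H y1).
Qed.

Fact vaddA : associative vadd.
Proof.
elim/vclassW=> x x0; elim/vclassW=> y y0; elim/vclassW=> z z0.
by rewrite !vaddE ?mulf_neq0 // mulrA.
Qed.

Fact vaddC : commutative vadd.
Proof. by move=> a b; rewrite /vadd mulrC. Qed.

Fact vadd0 : left_id (vclass 1) vadd.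
Proof. by elim/vclassW=> x x0; rewrite vaddE ?oner_neq0 // mul1r. Qed.

Fact vaddN : left_inverse (vclass 1) vopp vadd.
Proof.
move=> a; rewrite -{2}[a]vclass_repr -vclass_nz vaddE ?invr_eq0 //.
by rewrite mulVf.
Qed.

HB.instance Definition _ := GRing.isZmodule.Build value_quot vaddA vaddC vadd0 vaddN.

Fact vqle_refl : reflexive vqle. Proof. by move=> a; apply: vle_refl. Qed.

Fact vqle_anti : antisymmetric vqle.
Proof.
by move=> a b H; rewrite -[a]vclass_repr -[b]vclass_repr; apply/vclassP.
Qed.

Fact vqle_trans : transitive vqle. Proof. by move=> b a c; apply: vle_trans. Qed.

HB.instance Definition _ :=
  Order.Le_isPOrder.Build ring_display value_quot vqle_refl vqle_anti vqle_trans.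

Definition vr_val (x : K) : option value_quot :=
  if x == 0 then None else Some (vclass x).

Fact vr_val_ordered : totally_ordered_group value_quot.
Proof.
split=> [a b|]; first exact: vle_total.
elim/vclassW=> x x0; elim/vclassW=> y y0; elim/vclassW=> z z0 H.
rewrite /GRing.add /= !vaddE //; rewrite /Order.le /= vqleE in H *.
by have := vle_mul x H; rewrite vqleE (nzE x0) (nzE y0) (nzE z0).
Qed.

Fact vr_val_infty x : (vr_val x == None) = (x == 0).
Proof. by rewrite /vr_val; case: ifP. Qed.

Fact vr_val_mul x y : vr_val (x * y) = eadd (vr_val x) (vr_val y).
Proof.
rewrite /vr_val mulf_eq0; case: (eqVneq x 0) => //= x0; case: (eqVneq y 0) => //= y0.
by congr Some; rewrite [RHS]vaddE.
Qed.

Let ele_valE x y : x != 0 -> y != 0 ->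
  ele (vr_val x) (vr_val y) = `[< O (y / x) >].
Proof.
move=> x0 y0; rewrite /vr_val (negPf x0) (negPf y0) /= [LHS]vqleE.
by rewrite /vle !nzE.
Qed.

Fact vr_val_add x y : ele (emin (vr_val x) (vr_val y)) (vr_val (x + y)).
Proof.
have ele_r (a : option value_quot) : ele a a by case: a => //= b; apply: lexx.
have eleN (a : option value_quot) : ele a None by case: a.
have v0 : vr_val 0 = None by rewrite /vr_val eqxx.
have [->|x0] := eqVneq x 0.
  by rewrite add0r v0 /emin; case: (vr_val y) => [a|] //=; apply: lexx.
have [->|y0] := eqVneq y 0; first by rewrite addr0 v0 /emin eleN.
have [->|s0] := eqVneq (x + y) 0; first by rewrite v0.
have O1 := vr1 vO; rewrite /emin; case: ifP; rewrite !ele_valE //.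
  by move=> /asboolP H; apply/asboolP; rewrite mulrDl divff //; apply: vrD.
move=> /asboolP H; apply/asboolP; rewrite mulrDl divff //; apply: (vrD vO) => //.
by case: (vr_total vO (x / y)) => //; rewrite invf_div.
Qed.

Definition valring_valuation : valuation K :=
  Valuation vr_val_ordered vr_val_infty vr_val_mul vr_val_add.

Lemma valring_valuationE x : (x \in val_ring valring_valuation) = `[< O x >].
Proof.
rewrite inE /=; have [->|x0] := eqVneq x 0.
  by rewrite /vr_val eqxx /=; apply/esym/asboolP/(vr0 vO).
have E : vr_val 1 = Some 0 by rewrite /vr_val oner_eq0.
rewrite -[LHS]/(ele (Some (0 : value_quot)) (vr_val x)) -E.
by rewrite ele_valE ?oner_eq0 // divr1.
Qed.

End ValueGroup.

(** * Coarsening along a multiplicative subgroup *)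

Definition mult_subgroup (L : fieldType) (S : L -> Prop) : Prop :=
  [/\ S 1, forall x y, S x -> S y -> S (x * y), forall x, S x -> S x^-1 & ~ S 0].

(** For a valuation ring with units in [S] and maximal ideal [M], these are the [x] that map [M]
    minus [S] into [M], described without the ring. The test [S (1 + x * y)] decides whether [x * y]
    is in [M] only outside [S], which is ensured for [x] in [S]; an [x] outside [S] qualifies
    exactly when it is in [M]. *)
Definition unit_group_ring (L : fieldType) (S : L -> Prop) (x : L) : Prop :=
  (~ S x /\ S (1 + x)) \/
  (S x /\ forall y, ~ S y -> S (1 + y) -> S (1 + x * y)).

Section UnitGroup.
Context (L : fieldType) (O S : L -> Prop) (vO : valring O) (gS : mult_subgroup S).
Hypothesis units_S : forall x, x != 0 -> O x -> O x^-1 -> S x.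
Local Notation M := (vmax O).

Let SM x y : S x -> S y -> S (x * y). Proof. by case: gS => _ + _ _; apply. Qed.
Let SV x : S x -> S x^-1. Proof. by case: gS => _ _ + _; apply. Qed.
Let S0 : ~ S 0. Proof. by case: gS. Qed.

Let Sn0 x : S x -> x != 0.
Proof. by move=> Sx; apply/eqP => x0; rewrite x0 in Sx. Qed.

Let SMr x y : S x -> S (x * y) -> S y.
Proof. by move=> Sx Sxy; rewrite -[y](mulKf (Sn0 Sx)); apply: SM => //; apply: SV. Qed.

(** For [x] in [M], [1 + x] is a unit. If [x] is outside both [S] and [M], it is not in [O], so
    [1 + x = x (1 + x^-1)] is [x] times a unit and stays outside [S]. *)
Let notS_max x : ~ S x -> S (1 + x) <-> M x.
Proof.
move=> nSx; split=> [S1x|Mx]; last first.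
  have [n0 nM] := vmax_1D vO Mx.
  apply: units_S => //; last exact: vrV nM.
  by apply: vrD (vr1 vO) (vmax_sub vO Mx).
have [->|x0] := eqVneq x 0; first by left.
right=> OVx; have nOx : ~ O x by move=> Ox; apply: nSx; apply: units_S.
have [n0 nM] := vmax_1D vO (vmaxV nOx); apply: nSx.
apply: SMr (_ : S ((1 + x^-1) * x)); last by rewrite mulrDl mulVf // mul1r addrC.
apply: units_S => //; last exact: vrV nM.
by apply: vrD (vr1 vO) OVx.
Qed.

Lemma unit_group_ringE x :
  unit_group_ring S x <-> forall y, ~ S y -> M y -> M (x * y).
Proof.
split=> [[[nSx /(notS_max nSx) Mx] y _ My | [Sx H] y nSy My]|H].
- exact: (vmaxMl vO (vmax_sub vO Mx) My).
- apply/notS_max; first by move=> /(SMr Sx).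
  by apply: H => //; apply/notS_max.
have [Sx|nSx] := pselect (S x); [right|left]; split=> //.
  move=> y nSy /(notS_max nSy) My; apply/notS_max; first by move=> /(SMr Sx).
  exact: H.
apply/notS_max => //; apply: contrapT => nM.
have x0 : x != 0 by apply/eqP => x0; apply: nM; left.
have OVx := vrV nM.
have nOx : ~ O x by move=> Ox; apply: nSx; apply: units_S.
apply: (vmax1 vO); rewrite -(divff x0); apply: H; last exact: vmaxV.
by move=> /SV; rewrite invrK.
Qed.

Lemma unit_group_valring : valring (unit_group_ring S).
Proof.
have OE x : O x -> unit_group_ring S x.
  by move=> Ox; apply/unit_group_ringE => y _; apply: vmaxMl.
split=> [|x y|x y|x]; first exact/OE/(vr1 vO).
- move=> /unit_group_ringE Ex /unit_group_ringE Ey; apply/unit_group_ringE => z nS Mz.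
  by rewrite mulrBl; apply: (vmaxB vO); [apply: Ex | apply: Ey].
- move=> /unit_group_ringE Ex /[dup] Ey' /unit_group_ringE Ey.
  apply/unit_group_ringE => z nS Mz; rewrite -mulrA.
  (* A factor [y] outside [S] is itself in [M], so [x] sends it into [M]; a factor in [S] preserves
     the complement of [S]. *)
  case: Ey' => [[nSy /(notS_max nSy) My]|[Sy _]].
    by rewrite mulrA; apply: (vmaxMl vO (vmax_sub vO _) Mz); apply: Ex.
  by apply: Ex; [move=> /(SMr Sy) | apply: Ey].
- by case: (vr_total vO x) => /OE; [left | right].
Qed.

Lemma unit_group_ring_proper t : t != 0 -> ~ S t ->
  exists x, ~ unit_group_ring S x.
Proof.
move=> t0 nSt; have nSV : ~ S t^-1 by move=> /SV; rewrite invrK.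
have [Mt|nM] := pselect (M t).
  exists t^-1 => /unit_group_ringE /(_ t nSt Mt); rewrite mulVf //; exact: vmax1.
have nO : ~ O t by move=> Ot; apply/nSt/units_S => //; apply: vrV.
exists t => /unit_group_ringE /(_ t^-1 nSV (vmaxV nO)); rewrite divff //; exact: vmax1.
Qed.

End UnitGroup.

(** Zorn's lemma for reverse inclusion: along a chain of valuation rings the intersection is a
    valuation ring, and its maximal ideal is the union of theirs, hence inside [T]. As [Zorn_bigcup]
    takes unions, a ring is coded by its complement [X] in [O0]. *)
Lemma minimal_valring (L : fieldType) (O0 T : L -> Prop) :
    valring O0 -> (forall x, vmax O0 x -> T x) ->
  exists O, [/\ valring O, (forall x, O x -> O0 x), (forall x, vmax O x -> T x) &
    forall O', valring O' -> (forall x, O' x -> O x) ->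
      (forall x, vmax O' x -> T x) -> forall x, O x -> O' x].
Proof.
move=> vO0 MT0; pose R (X : set L) x := O0 x /\ ~ X x.
pose P (X : set L) := valring (R X) /\ forall x, vmax (R X) x -> T x.
have RX (O : L -> Prop) : (forall x, O x -> O0 x) -> R (~` O)%classic = O.
  move=> sO; apply: funext => x; apply: propext; split=> [[_]|Ox]; first exact: contrapT.
  by split; [apply: sO | apply].
have [F FP Ftot|X [[vR MR] maxX]] := @Zorn_bigcup L P.
  have RF X x : F X -> R (\bigcup_(X in F) X)%classic x -> R X x.
    by move=> FX [Ox nF]; split=> // Xx; apply: nF; exists X.
  have FR x : O0 x -> (forall X, F X -> R X x) -> R (\bigcup_(X in F) X)%classic x.
    by move=> Ox H; split=> // -[X FX Xx]; case: (H X FX).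
  split.
    split=> [|x y|x y|x].
    - apply: FR => [|X FX]; first exact: vr1 vO0.
      by have [/vr1 ] := FP _ FX.
    - move=> Rx Ry; apply: FR => [|X FX]; first by apply: (vrB vO0); case: Rx; case: Ry.
      by have [/vrB + _] := FP _ FX; apply; apply: RF.
    - move=> Rx Ry; apply: FR => [|X FX]; first by apply: (vrM vO0); case: Rx; case: Ry.
      by have [/vrM + _] := FP _ FX; apply; apply: RF.
    - have [Ox|nOx] := pselect (R (\bigcup_(X in F) X)%classic x); first by left.
      right; have [O0x|nO0x] := pselect (O0 x); last first.
        have OV : O0 x^-1 by case: (vr_total vO0 x).
        apply: FR => // X FX; have [vX _] := FP _ FX.
        by case: (vr_total vX x) => // -[].
      have [X FX nX] : exists2 X, F X & ~ R X x.
        apply: contrapT => H; apply: nOx; apply: FR => // X FX.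
        by apply: contrapT => nX; apply: H; exists X.
      have Xx : X x by apply: contrapT => nXx; apply: nX.
      have XV : R X x^-1 by have [vX _] := FP _ FX; case: (vr_total vX x).
      apply: FR => [|Y FY]; first by case: XV.
      have [sXY|sYX] := Ftot _ _ FX FY; last by case: XV => O0V nV; split=> // /sYX.
      have [vY _] := FP _ FY; case: (vr_total vY x) => // -[_ nYx].
      by case: nYx; apply: sXY.
  move=> x [->|nR]; first by apply: MT0; left.
  have [O0V|nOV] := pselect (O0 x^-1); last by apply: MT0; right.
  apply: contrapT => nT; apply: nR; apply: FR => // X FX.
  by have [_ MX] := FP _ FX; apply: contrapT => nX; apply: nT; apply: MX; right.
exists (R X); split=> // [x []//|O' vO' sO' MO' x Rx].
apply: contrapT => nO'x; have sO0 y : O' y -> O0 y by move=> /sO' [].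
apply: (maxX (~` O')%classic); last by rewrite /P RX.
split; last by move=> sX; apply: (Rx.2); apply: sX.
by move=> y Xy O'y; case: (sO' _ O'y).
Qed.

(** * Neighbourhoods in a minimal valuation ring *)

Section Frobenius.
Context (L : fieldType) (p : nat) (pL : p \in [pchar L]).

Lemma frobeniusB j (x y : L) : (x - y) ^+ (p ^ j) = x ^+ (p ^ j) - y ^+ (p ^ j).
Proof.
elim: j => [|j IH]; first by rewrite !expr1.
rewrite expnSr !exprM IH -!(pFrobenius_autE pL).
exact: (rmorphB (pFrobenius_aut pL)).
Qed.

Lemma frobeniusD j (x y : L) : (x + y) ^+ (p ^ j) = x ^+ (p ^ j) + y ^+ (p ^ j).
Proof.
elim: j => [|j IH]; first by rewrite !expr1.
rewrite expnSr !exprM IH -!(pFrobenius_autE pL).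
exact: (rmorphD (pFrobenius_aut pL)).
Qed.

Lemma pchar_gt0 : (0 < p)%N. Proof. exact: prime_gt0 (pcharf_prime pL). Qed.

End Frobenius.

(** The clauses are the axioms of a V-topology: up to the factor [c], differences and products of
    elements of [U] return to [U], and so do inverses of elements outside [U]. Only [U] occurs, so
    definability is inherited from [U]. *)
Definition conductor (L : fieldType) (U : L -> Prop) (c : L) : Prop :=
  [/\ forall x y, U x -> U y -> U (c * x - c * y),
      forall x y, U x -> U y -> U (c * x * y) & forall y, ~ U y -> U (c / y)].

Section Conductor.
Context (L : fieldType) (p : nat) (pL : p \in [pchar L]).
Context (O U : L -> Prop) (vO : valring O).
Local Notation M := (vmax O).
Hypothesis MU : forall x, M x -> U x.
Hypothesis UO : forall x, U x -> O x.
Hypothesis U1 : ~ U 1.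

Lemma vmax_conductor c : M c -> conductor U c.
Proof.
move=> Mc; split=> [x y /UO Ox /UO Oy|x y /UO Ox /UO Oy|y nUy]; apply: MU.
- by apply: (vmaxB vO); apply: (vmaxMr vO).
- by apply: (vmaxMr vO) => //; apply: (vmaxMr vO).
- by apply: (vmaxMr vO) => //; apply: vrV => My; apply/nUy/MU.
Qed.

Hypothesis minO : forall O', valring O' -> (forall x, O' x -> O x) ->
  (forall x, vmax O' x -> exists j, U (x ^+ (p ^ j))) -> forall x, O x -> O' x.

Section PowerBounded.
Context (c : L) (Dc : conductor U c) (nMc : ~ M c).

Let U0 : U 0. Proof. by apply: MU; left. Qed.
Let c0 : c != 0. Proof. by apply/eqP => c0; apply: nMc; left. Qed.
Let Uc : U c. Proof. by case: Dc => _ _ /(_ 1 U1); rewrite divr1. Qed.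
Let UB x y : U x -> U y -> U (c * x - c * y). Proof. by case: Dc => + _ _; apply. Qed.
Let UM x y : U x -> U y -> U (c * x * y). Proof. by case: Dc => _ + _; apply. Qed.
Let UV x : ~ U x -> U (c / x). Proof. by case: Dc => _ _; apply. Qed.
Let Ucx x : U x -> U (c * x).
Proof. by move=> /UB /(_ U0); rewrite mulr0 subr0. Qed.
Let UcX n x : U x -> U (c ^+ n * x).
Proof.
by move=> Ux; elim: n => [|n IH]; rewrite ?mul1r // exprS -mulrA; apply: Ucx.
Qed.
Let Ucle m n x : (m <= n)%N -> U (c ^+ m * x) -> U (c ^+ n * x).
Proof. by move=> /subnK <-; rewrite exprD -mulrA; apply: UcX. Qed.

(* Elements whose [p ^ j]-th powers stay bounded in the ring topology with     *)
(* neighbourhoods [c ^+ m U] of zero. In characteristic [p] they form a ring.  *)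
Definition power_bounded (x : L) : Prop :=
  exists m i, forall j, (i <= j)%N -> U (c ^+ m * x ^+ (p ^ j)).

Let pbE x : power_bounded x -> exists m i, forall n j,
  (m <= n)%N -> (i <= j)%N -> U (c ^+ n * x ^+ (p ^ j)).
Proof.
by case=> m [i H]; exists m, i => n j mn ij; apply: Ucle mn _; apply: H.
Qed.

Lemma power_bounded_valring : valring power_bounded.
Proof.
split=> [|x y|x y|x].
- by exists 1%N, 0%N => j _; rewrite expr1n mulr1 expr1; apply: Uc.
- case/pbE=> [m [i Hx]] /pbE [n [k Hy]].
  exists (maxn m n).+1, (maxn i k) => j; rewrite geq_max => /andP[ij kj].
  rewrite (frobeniusB pL) mulrBr exprS -!mulrA.
  by apply: UB; [apply: Hx | apply: Hy]; rewrite // ?leq_maxl ?leq_maxr.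
- case/pbE=> [m [i Hx]] /pbE [n [k Hy]].
  exists (m + n).+1, (maxn i k) => j; rewrite geq_max => /andP[ij kj].
  have := UM (Hx _ _ (leqnn m) ij) (Hy _ _ (leqnn n) kj).
  by rewrite exprMn exprS exprD; congr U; ring.
(* If [c^-1 x^(p^i)] is in [U] for one [i], the product axiom keeps all later powers in [U]; if for
   none, the inversion axiom bounds the powers of [x^-1], with factor [c^2]. *)
have [[i Ui]|nU] := pselect (exists i, U (c^-1 * x ^+ (p ^ i))); [left|right].
  exists 0%N, i => j /subnK <-; rewrite mul1r.
  suff: U (c^-1 * (x ^+ (p ^ i)) ^+ (p ^ (j - i)).-1.+1).
    move=> /Ucx; rewrite mulVKf // prednK ?expn_gt0 ?(pchar_gt0 pL) //.
    by rewrite -exprM -expnD addnC.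
  elim: (_.-1) => [|n IH]; first by rewrite expr1.
  move: (x ^+ _) Ui IH => y Ui /(UM Ui); rewrite (exprS _ n.+1).
  by congr U; field.
exists 2, 0%N => j _.
have : ~ U (c^-1 * x ^+ (p ^ j)) by move=> Uj; apply: nU; exists j.
by move=> /UV; rewrite invfM invrK exprVn; congr U; ring.
Qed.

Lemma power_bounded_sub x : power_bounded x -> O x.
Proof.
case=> m [i /(_ i (leqnn i)) /UO Oc].
have Ocv : O c^-1 by apply: vrV.
have : O (x ^+ (p ^ i)).
  by rewrite -[x ^+ _](mulKf (expf_neq0 m c0)) -exprVn; apply: vrM => //; apply: vrX.
by rewrite -[(p ^ i)%N]prednK ?expn_gt0 ?(pchar_gt0 pL) //; apply: vr_root.
Qed.

(** If [x^-1] is not power bounded, some [c x^(-p^j)] is outside [U], and the inversion axiom puts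
    [x^(p^j)] in [U]. This is the condition under which [minO] applies. *)
Lemma power_bounded_max x : vmax power_bounded x -> exists j, U (x ^+ (p ^ j)).
Proof.
case=> [->|nB]; first by exists 0%N; rewrite expr1.
have [j nU] : exists j, ~ U (c * x^-1 ^+ (p ^ j)).
  apply: contrapT => H; apply: nB; exists 1%N, 0%N => j _; rewrite expr1.
  by apply: contrapT => nU; apply: H; exists j.
exists j; move/UV: nU; rewrite exprVn; congr U.
by rewrite invfM invrK mulrA divff // mul1r.
Qed.

(** Once [p^j >= m], having [c^m c^(-p^j)] in [U] would give 1 in [U] after multiplication by powers
    of [c]. *)
Lemma not_power_boundedV : ~ power_bounded c^-1.
Proof.
case=> m [i H]; have lt_j j : (j <= p ^ j)%N.
  by apply/ltnW/ltn_expl/prime_gt1/(pcharf_prime pL).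
have := H _ (leq_maxr m i); set j := maxn m i; move=> /(UcX (p ^ j - m)).
rewrite mulrA -exprD subnK; last exact: leq_trans (leq_maxl m i) (lt_j j).
by rewrite exprVn divff ?expf_neq0.
Qed.

End PowerBounded.

(** For a conductor [c] outside [M], the power bounded elements would form a valuation ring inside
    [O], equal to [O] by minimality and yet missing [c^-1]. *)
Lemma conductor_vmax c : conductor U c <-> M c.
Proof.
split=> [Dc|]; last exact: vmax_conductor.
apply: contrapT => nMc; apply: (not_power_boundedV Dc nMc).
apply: minO; last exact: vrV.
- exact: power_bounded_valring.
- exact: power_bounded_sub.
- exact: power_bounded_max.
Qed.

End Conductor.

(** * Additive subgroups and their transporters *)

(** If [O] lies in [A], this describes the [x] with [x O] inside [A] without naming [O], in the
    setting of [transporterE]. If not, it serves as a definable set between [M] and [O]. *)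
Definition transporter (L : fieldType) (A : L -> Prop) (x : L) : Prop :=
  forall s, ~ A s -> A (x / s).

Definition add_subgroup (L : fieldType) (A : L -> Prop) : Prop :=
  A 0 /\ forall x y, A x -> A y -> A (x - y).

Section Transporter.
Context (L : fieldType) (O A : L -> Prop) (vO : valring O) (gA : add_subgroup A).
Local Notation M := (vmax O).
Hypothesis MA : forall x, M x -> A x.

Let A0 : A 0. Proof. by case: gA. Qed.
Let AB x y : A x -> A y -> A (x - y). Proof. by case: gA => _; apply. Qed.
Let AD x y : A x -> A y -> A (x + y).
Proof. by move=> Ax Ay; rewrite -[y]opprK -[- y]sub0r; apply: AB => //; apply: AB. Qed.

Lemma vmax_transporter x : M x -> transporter A x.
Proof.
move=> Mx s nAs; apply/MA/(vmaxMr vO) => //; apply: vrV => Ms; exact/nAs/MA.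
Qed.

(* With [a := s ^+ 3 / (x - s ^+ 2)] one has [x / s - x / (s + a) = s].        *)
Lemma not_transporter x s : x != 0 -> ~ A s -> M (s ^+ 2 / x) -> M (s ^+ 3 / x) ->
  ~ transporter A x.
Proof.
move=> x0 nAs M2 M3 Tx.
have s0 : s != 0 by apply/eqP => s0; apply: nAs; rewrite s0.
have [n0 nM] := vmax_1D vO (vmaxN vO M2).
have d0 : x - s ^+ 2 != 0.
  rewrite (_ : x - _ = x * (1 - s ^+ 2 / x)) ?mulf_neq0 //.
  by rewrite mulrBr mulr1 mulrCA divff // mulr1.
pose a := s ^+ 3 / (x - s ^+ 2).
have Ma : M a.
  rewrite (_ : a = s ^+ 3 / x * (1 - s ^+ 2 / x)^-1).
    by apply: (vmaxMr vO) => //; apply: vrV.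
  by rewrite /a -mulrA -invfM mulrBr mulr1 mulrCA divff // mulr1.
have nAsa : ~ A (s + a) by move=> /AB /(_ (MA Ma)); rewrite addrK.
have saE : s + a = s * x / (x - s ^+ 2) by rewrite /a; field.
apply: (nAs); have := AB (Tx _ nAs) (Tx _ nAsa); congr A.
by rewrite saE; field; rewrite d0 x0.
Qed.

Section Perfect.
Context (p : nat) (pL : p \in [pchar L]).
Hypothesis perfL : forall x : L, exists y, y ^+ p = x.
Hypothesis AS : forall x, A (x ^+ p - x).
Hypothesis OA : forall x, O x -> A x.

Let p_gt1 : (1 < p)%N. Proof. exact: prime_gt1 (pcharf_prime pL). Qed.

Let I x := forall y, O y -> A (x * y).

Let IM x y : I x -> O y -> I (x * y).
Proof. by move=> Ix Oy z Oz; rewrite -mulrA; apply: Ix; apply: vrM. Qed.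

(** Perfectness gives [y = z^p], and [x^p y = ((x z)^p - x z) + x z] is an Artin-Schreier value plus
    an element of [x O]. *)
Let IX x : I x -> I (x ^+ p).
Proof.
move=> Ix y Oy; have [z zE] := perfL y.
have Oz : O z by apply: (@vr_root _ _ vO _ p.-1); rewrite prednK ?zE // (pchar_gt0 pL).
rewrite -zE -exprMn -[_ ^+ p](subrK (x * z)); exact: AD (AS _) (Ix _ Oz).
Qed.

Let I1 : I 1. Proof. by move=> y Oy; rewrite mul1r; apply: OA. Qed.

Let OI x : O x -> I x. Proof. by move=> Ox; rewrite -[x]mul1r; exact (IM I1 Ox). Qed.

Let I2 x : I x -> I (x ^+ 2).
Proof.
move=> Ix; have [Ox|OVx] := vr_total vO x; first exact (IM Ix Ox).
have [->|x0] := eqVneq x 0; first by rewrite expr0n; apply/OI/(vr0 vO).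
rewrite (_ : x ^+ 2 = x ^+ p * x^-1 ^+ (p - 2)); first exact (IM (IX Ix) (vrX vO _ OVx)).
by rewrite -{1}(subnK p_gt1) exprD exprVn mulrAC divff ?mul1r ?expf_neq0.
Qed.

(** If [x O] is not inside [A], take the [p^2]-th root [r] of [x]. By [IX] some [s = r y] with [y]
    in [O] is outside [A]; as [p^2 > 3] and [r] is not in [O], both [s^2 / x] and [s^3 / x] are in
    [M], and [not_transporter] applies. Conversely, if [x / s] is not in [O], then [s] is in [x O],
    hence in [A]. *)
Lemma transporterE x : transporter A x <-> forall y, O y -> A (x * y).
Proof.
split=> [Tx|Ix s nAs]; last first.
  have [->|x0] := eqVneq x 0; first by rewrite mul0r.
  have s0 : s != 0 by apply/eqP => s0; apply: nAs; rewrite s0.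
  have [/OA//|Osx] := vr_total vO (x / s).
  case: nAs; rewrite invf_div in Osx.
  by rewrite -[s](divfK x0) mulrC; apply: Ix.
apply: contrapT => nIx; have x0 : x != 0.
  by apply/eqP => x0; apply: nIx; rewrite x0; apply/OI/(vr0 vO).
have [r1 r1E] := perfL x; have [r rE] := perfL r1.
have nIr : ~ I r by move=> /IX /IX; rewrite rE r1E.
have [y [Oy nAs]] : exists y, O y /\ ~ A (r * y).
  apply: contrapT => H; apply: nIr => y Oy; apply: contrapT => nA.
  by apply: H; exists y.
have nOr : ~ O r by move=> /OI.
have MrV := vmaxV nOr.
have r0 : r != 0 by apply/eqP => r0; apply: nOr; rewrite r0; apply: vr0 vO.
have p4 : (4 <= p * p)%N by rewrite (leq_mul p_gt1 p_gt1).
have Mk k : (k < 4)%N -> M ((r * y) ^+ k / x).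
  move=> k4; have kp := leq_trans k4 p4.
  rewrite (_ : _ / x = r^-1 ^+ (p * p - k) * y ^+ k).
    by apply: (vmaxMr vO); [rewrite -subnSK //; apply: vmaxX | apply: vrX].
  rewrite -r1E -rE -exprM exprMn exprVn mulrAC; congr (_ * _).
  have -> : r ^+ (p * p) = r ^+ (p * p - k) * r ^+ k by rewrite -exprD subnK // ltnW.
  by rewrite invfM mulrCA divff ?mulr1 ?expf_neq0.
exact: not_transporter x0 nAs (Mk 2 isT) (Mk 3 isT) Tx.
Qed.

(** For products, [x y] is the square of [x] or of [y] times an element of [O], and [I2] handles
    squares. *)
Lemma transporter_valring : valring (transporter A).
Proof.
split=> [|x y Tx Ty s nA|x y /transporterE Ix /transporterE Iy|x].
- exact/transporterE/I1.
- by rewrite mulrBl; apply: AB; [apply: Tx | apply: Ty].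
- apply/transporterE; have [->|x0] := eqVneq x 0; first by rewrite mul0r; apply/OI/(vr0 vO).
  have [->|y0] := eqVneq y 0; first by rewrite mulr0; apply/OI/(vr0 vO).
  have [O1|O1] := vr_total vO (x / y).
    rewrite (_ : x * y = y ^+ 2 * (x / y)); last by field.
    exact (IM (I2 Iy) O1).
  rewrite (_ : x * y = x ^+ 2 * (x / y)^-1); last by field; rewrite x0 y0.
  exact (IM (I2 Ix) O1).
- by case: (vr_total vO x) => /OI; [left|right]; apply/transporterE.
Qed.

End Perfect.
End Transporter.

(** * Definability in a finite extension *)

(* Definability in [K] of relations on a finite extension [L] of [K]: an       *)
(* environment [e] over [L] is coded by the environment over [K] whose         *)
(* [d * i + j]-th entry is the [j]-th coordinate of [e`_i].                    *)
Section Interpretation.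
Context (K : fieldType) (L : fieldExtType K).
Local Notation d := (\dim {:L}).
Local Notation b := (vbasis {:L}).
Implicit Types (P Q : seq L -> Prop) (i : nat).

Definition codes (e : seq L) (e' : seq K) : Prop :=
  forall i, e`_i = \sum_(j < d) e'`_(d * i + j) *: b`_j.

Definition defn P : Prop := exists f : GRing.formula K,
  forall e e', codes e e' -> P e <-> GRing.holds e' f.

Definition def1 (S : L -> Prop) : Prop := forall i, defn (fun e => S e`_i).

Lemma defn_ext P Q : (forall e, P e <-> Q e) -> defn P -> defn Q.
Proof. by move=> PQ [f H]; exists f => e e' /H <-; rewrite PQ. Qed.

Lemma defn_and P Q : defn P -> defn Q -> defn (fun e => P e /\ Q e).
Proof.
by move=> [f Hf] [g Hg]; exists (GRing.And f g) => e e' c /=; rewrite (Hf e e') // (Hg e e').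
Qed.

Lemma defn_not P : defn P -> defn (fun e => ~ P e).
Proof. by move=> [f Hf]; exists (GRing.Not f) => e e' c /=; rewrite (Hf e e'). Qed.

Lemma defn_or P Q : defn P -> defn Q -> defn (fun e => P e \/ Q e).
Proof.
by move=> [f Hf] [g Hg]; exists (GRing.Or f g) => e e' c /=; rewrite (Hf e e') // (Hg e e').
Qed.

Lemma defn_imp P Q : defn P -> defn Q -> defn (fun e => P e -> Q e).
Proof.
by move=> [f Hf] [g Hg]; exists (GRing.Implies f g) => e e' c /=; rewrite (Hf e e') // (Hg e e').
Qed.

Lemma defn_exseq (A : eqType) (s : seq A) (P : A -> seq L -> Prop) :
  (forall a, defn (P a)) -> defn (fun e => exists2 a, a \in s & P a e).
Proof.
move=> dP; elim: s => [|a s IH]; first by exists (GRing.Bool false) => e e' _; split=> // -[].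
apply: defn_ext (defn_or (dP a) IH) => e; split.
  by case=> [Pa|[c cs Pc]]; [exists a; rewrite ?mem_head | exists c; rewrite // inE cs orbT].
by case=> c; rewrite inE => /predU1P[-> | cs Pc]; [left | right; exists c].
Qed.

Let dgt0 : (0 < d)%N. Proof. exact: (adim_gt0 {:L}%AS). Qed.

Let coordE (x : L) : x = \sum_(j < d) coord b j x *: b`_j.
Proof. exact: coord_vbasis (memvf x). Qed.

Let coordK (k : 'I_d -> K) j : coord b j (\sum_(j < d) k j *: b`_j) = k j.
Proof. exact/coord_sum_free/basis_free/vbasisP. Qed.

Let block i k : (k \in [seq (d * i + j)%N | j <- iota 0 d]) = (k %/ d == i)%N.
Proof.
apply/mapP/eqP => [[j]|<-].
  by rewrite mem_iota /= => jd ->; rewrite mulnC divnMDl // divn_small // addn0.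
by exists (k %% d)%N; rewrite ?mem_iota ?ltn_mod // mulnC -divn_eq.
Qed.

Let block_div i j : (j < d)%N -> ((d * i + j) %/ d = i)%N * ((d * i + j) %% d = j)%N.
Proof.
by move=> jd; rewrite mulnC modnMDl modn_small // divnMDl // divn_small // addn0.
Qed.

(** A quantifier over [L] becomes [d] quantifiers over [K], on the block of variables coding the
    [i]-th entry. *)
Lemma defn_ex i P : defn P -> defn (fun e => exists x, P (set_nth 0 e i x)).
Proof.
move=> [f Hf]; pose I := [seq (d * i + j)%N | j <- iota 0 d].
exists (foldr GRing.Exists f I) => e e' c; rewrite -GRing.foldExistsP; split.
- case=> x Px; pose h k := if insub (k %% d)%N is Some j then coord b j x else 0.
  pose g k := if (k %/ d == i)%N then h k else e'`_k.
  pose e'' := mkseq g (maxn (size e') (d * i + d))%N.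
  have e''E k : e''`_k = g k.
    have [lt|ge] := ltnP k (maxn (size e') (d * i + d)); first exact: nth_mkseq.
    rewrite nth_default ?size_mkseq // /g; move: ge; rewrite geq_max => /andP[ge1 ge2].
    case: eqP => [ki|_]; last by rewrite nth_default.
    by move: ge2; rewrite leqNgt {1}(divn_eq k d) ki mulnC ltn_add2l ltn_mod dgt0.
  exists e''; last first.
    apply/(Hf (set_nth 0 e i x)) => // m; rewrite nth_set_nth /=; case: eqP => [->|/eqP mi].
      rewrite [LHS]coordE; apply: eq_bigr => j _; rewrite e''E /g /h !block_div // eqxx.
      by rewrite insubT //= => H; congr (coord _ _ _ *: _); apply: val_inj.
    by rewrite c; apply: eq_bigr => j _; rewrite e''E /g block_div // (negPf mi).
  by move=> k; rewrite !inE block => /negPf ki; rewrite e''E /g ki.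
- case=> e'' same H; exists (\sum_(j < d) e''`_(d * i + j) *: b`_j).
  apply/(Hf _ e'') => // m; rewrite nth_set_nth /=; case: eqP => [->//|/eqP mi].
  rewrite c; apply: eq_bigr => j _; rewrite same // !inE block block_div //.
Qed.

Lemma defn_all i P : defn P -> defn (fun e => forall x, P (set_nth 0 e i x)).
Proof.
move=> /defn_not /(defn_ex i) /defn_not; apply: defn_ext => e; split.
  by move=> H x; apply: contrapT => nP; apply: H; exists x.
by move=> H [x]; apply.
Qed.

Let sclr (g : seq K -> K) := exists t, forall e', GRing.eval e' t = g e'.

Definition trm (t : seq L -> L) : Prop := exists g : 'I_d -> seq K -> K,
  (forall j, sclr (g j)) /\
  forall e e', codes e e' -> t e = \sum_(j < d) g j e' *: b`_j.

Let sclr_sum (I : Type) (r : seq I) (g : I -> seq K -> K) :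
  (forall j, sclr (g j)) -> sclr (fun e' => \sum_(j <- r) g j e').
Proof.
move=> H; elim: r => [|j r [t tE]].
  by exists (GRing.Const 0) => e'; rewrite big_nil.
have [u uE] := H j; exists (GRing.Add u t) => e'.
by rewrite big_cons /= uE tE.
Qed.

Let sclr_mul g h : sclr g -> sclr h -> sclr (fun e' => g e' * h e').
Proof. by case=> t tE [u uE]; exists (GRing.Mul t u) => e' /=; rewrite tE uE. Qed.

Lemma trm_var i : trm (fun e => e`_i).
Proof.
exists (fun j e' => e'`_(d * i + j)); split; last by move=> e e' ->.
by move=> j; exists (GRing.Var _ (d * i + j)).
Qed.

Lemma trm_const a : trm (fun=> a).
Proof.
exists (fun j e' => coord b j a); split; last by move=> e e' _; apply: coordE.
by move=> j; exists (GRing.Const (coord b j a)).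
Qed.

Lemma trm_add t u : trm t -> trm u -> trm (fun e => t e + u e).
Proof.
move=> [g [sg Eg]] [h [sh Eh]]; exists (fun j e' => g j e' + h j e'); split.
  by move=> j; have [x xE] := sg j; have [y yE] := sh j; exists (GRing.Add x y) => e' /=; rewrite xE yE.
move=> e e' c; rewrite (Eg e e') // (Eh e e') // -big_split /=.
by apply: eq_bigr => j _; rewrite scalerDl.
Qed.

Lemma trm_mul t u : trm t -> trm u -> trm (fun e => t e * u e).
Proof.
move=> [g [sg Eg]] [h [sh Eh]].
exists (fun k e' => \sum_(i < d) \sum_(j < d) g i e' * h j e' * coord b k (b`_i * b`_j)); split.
  move=> k; apply: sclr_sum => i; apply: sclr_sum => j.
  by do 2?apply: sclr_mul => //; exists (GRing.Const (coord b k (b`_i * b`_j))).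
move=> e e' c; rewrite (Eg e e') // (Eh e e') // mulr_suml.
under [RHS]eq_bigr do rewrite scaler_suml.
rewrite exchange_big /=; apply: eq_bigr => i _; rewrite mulr_sumr.
under [RHS]eq_bigr do rewrite scaler_suml.
rewrite exchange_big /=; apply: eq_bigr => j _.
rewrite -scalerAl -scalerAr scalerA [in LHS](coordE (b`_i * b`_j)) scaler_sumr.
by apply: eq_bigr => k _; rewrite scalerA.
Qed.

Lemma trm_exp t n : trm t -> trm (fun e => t e ^+ n).
Proof.
move=> Ht; elim: n => [|n IH]; first exact: trm_const.
have [g [sg Eg]] := trm_mul Ht IH; exists g; split=> // e e' c.
by rewrite exprS (Eg e e').
Qed.

Lemma trm_opp t : trm t -> trm (fun e => - t e).
Proof.
move=> Ht; have [g [sg Eg]] := trm_mul (trm_const (-1)) Ht; exists g; split=> // e e' c.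
by rewrite -(Eg e e') // mulN1r.
Qed.

Lemma defn_eq t u : trm t -> trm u -> defn (fun e => t e = u e).
Proof.
move=> [g [sg Eg]] [h [sh Eh]].
have [f Hf] : exists f, forall e', GRing.holds e' f <-> forall j, j \in enum 'I_d -> g j e' = h j e'.
  elim: (enum 'I_d) => [|j r [f Hf]]; first by exists (GRing.Bool true).
  have [x xE] := sg j; have [y yE] := sh j.
  exists (GRing.And (GRing.Equal x y) f) => e' /=; rewrite xE yE Hf; split.
    by case=> E H k; rewrite inE => /predU1P[->//|]; apply: H.
  by move=> H; split=> [|k kr]; apply: H; rewrite inE ?eqxx ?kr ?orbT.
exists f => e e' c; rewrite Hf (Eg e e') // (Eh e e') //; split=> [E j _|H].
  by rewrite -(coordK (g^~ e')) E coordK.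
by apply: eq_bigr => j _; rewrite H // mem_enum.
Qed.

(* [k] is a fresh variable, which holds the value of [t].                      *)
Lemma def1_subst k S t : def1 S -> trm t -> (forall e x, t (set_nth 0 e k x) = t e) ->
  defn (fun e => S (t e)).
Proof.
move=> dS dt tk.
apply: defn_ext (defn_ex k (defn_and (defn_eq (trm_var k) dt) (dS k))) => e; split.
  by case=> x; rewrite tk nth_set_nth /= eqxx => -[->].
by move=> St; exists (t e); rewrite tk nth_set_nth /= eqxx.
Qed.

(** The one-entry environment [x] codes [x b_0] rather than the scalar [x], whence the division by
    [b_0]. *)
Lemma def1_scalar S : def1 S -> exists f : GRing.formula K,
  forall x : K, S x%:A <-> GRing.holds [:: x] f.
Proof.
move=> dS; pose P e := exists y, (y * b`_0 = e`_0) /\ S y.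
have [f Hf] : defn P.
  apply: defn_ext (defn_ex 1 (defn_and (defn_eq (trm_mul (trm_var 1) (trm_const b`_0))
    (trm_var 0)) (dS 1%N))) => e.
  by split=> -[y]; rewrite ?nth_set_nth /= => H; exists y; rewrite ?nth_set_nth.
have b0 : b`_0 != 0.
  by apply: (free_not0 (basis_free (vbasisP {:L}))); rewrite mem_nth // size_tuple.
exists f => x; rewrite -(Hf [:: x *: b`_0]).
  split=> [Sx|[y []]] /=; first by exists x%:A; rewrite mulr_algl.
  by rewrite -[x *: b`_0]mulr_algl => /(mulIf b0) ->.
case=> [|i] /=; last first.
  rewrite nth_nil big1 // => j _; rewrite nth_default ?scale0r //=.
  by rewrite (leq_trans _ (leq_addr _ _)) // muln_gt0 dgt0.
rewrite (bigD1 (Ordinal dgt0)) //= muln0 big1 ?addr0 // => j.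
by rewrite -val_eqE /= => j0; rewrite nth_default ?scale0r //= lt0n.
Qed.

End Interpretation.

(** * Definable valuation rings *)

Section DefinableRings.
Context (K : fieldType) (L : fieldExtType K).
Implicit Types (S U A O : L -> Prop).

Let ne i : ((i == i.+1) = false) * ((i == i.+2) = false) * ((i.+1 == i.+2) = false) *
  ((i == i.+3) = false) * ((i.+1 == i.+3) = false) * ((i.+2 == i.+3) = false).
Proof. by do !split; apply/ltn_eqF; rewrite ?ltnS ?leqnSn // ltnW. Qed.

Let nth_set (e : seq L) i j x : (set_nth 0 e i x)`_j = if j == i then x else e`_j.
Proof. by rewrite nth_set_nth. Qed.

Let nthS := (nth_set, ne).

Lemma def1_mult_cosets n S : mult_subgroup S -> (forall y, y != 0 -> S (y ^+ n)) ->
  finite_index *%R (@mult_group L) (@mult_powers L n) -> def1 S.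
Proof.
move=> [S1 SM SV S0] Sn [s [s0 cov]] i; pose s' := [seq a <- s | `[< S a >]].
have H a : defn (fun e : seq L => exists y, y != 0 /\ e`_i = a * y ^+ n).
  apply: defn_ext (defn_ex i.+1 (defn_and (defn_not (defn_eq (trm_var _ i.+1) (trm_const 0)))
    (defn_eq (trm_var _ i) (trm_mul (trm_const a) (trm_exp n (trm_var _ i.+1)))))) => e.
  by split=> -[y]; rewrite /= ?nthS ?eqxx /= => -[/eqP y0 E]; exists y; rewrite /= ?nthS ?eqxx /= //; split=> //; apply/eqP.
apply: defn_ext (defn_exseq s' H) => e; split.
  by case=> a; rewrite mem_filter => /andP[/asboolP Sa _] [y [/Sn Sy ->]]; apply: SM.
move=> Se; have [|a as_ [h [y yn0 hE] eE]] := cov e`_i.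
  by apply/eqP => e0; apply: S0; rewrite -e0.
have Sh : S h by rewrite hE; apply: Sn.
exists a; last by exists y; rewrite eE hE.
rewrite mem_filter as_ andbT; apply/asboolP.
have h0 : h != 0 by apply: contra_notN S0 => /eqP <-.
by rewrite -[a](mulfK h0) -eE; apply: SM => //; apply: SV.
Qed.

Lemma def1_add_cosets p A : add_subgroup A -> (forall y, A (y ^+ p - y)) ->
  finite_index +%R (@add_group L) (@artin_schreier_image L p) -> def1 A.
Proof.
move=> [A0 AB] Ap [s [_ cov]] i; pose s' := [seq a <- s | `[< A a >]].
have H a : defn (fun e : seq L => exists y, e`_i = a + (y ^+ p - y)).
  apply: defn_ext (defn_ex i.+1 (defn_eq (trm_var _ i) (trm_add (trm_const a)
   (trm_add (trm_exp p (trm_var _ i.+1)) (trm_opp (trm_var _ i.+1)))))) => e.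
  by split=> -[y]; rewrite /= ?nthS ?eqxx /= => E; exists y; rewrite /= ?nthS ?eqxx /=.
have AN x : A x -> A (- x) by rewrite -sub0r; apply: AB.
apply: defn_ext (defn_exseq s' H) => e; split.
  case=> a; rewrite mem_filter => /andP[/asboolP Aa _] [y ->].
  by rewrite -[_ - y]opprK; apply: AB => //; apply: AN.
move=> Ae; have [//|a as_ [h [y hE] eE]] := cov e`_i.
exists a; last by exists y; rewrite eE hE.
rewrite mem_filter as_ andbT; apply/asboolP.
by rewrite -[a](addrK h) -eE; apply: AB => //; rewrite hE.
Qed.

Lemma def1_unit_group_ring S : def1 S -> def1 (unit_group_ring S).
Proof.
move=> dS i.
have d1 j k : j != k -> defn (fun e : seq L => S (1 + e`_j)).
  move=> jk; apply: (@def1_subst _ _ k) => //; first exact: trm_add (trm_const 1) (trm_var _ j).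
  by move=> e x; rewrite /= nth_set_nth /= (negPf jk).
have d2 : defn (fun e : seq L => S (1 + e`_i * e`_i.+1)).
  apply: (@def1_subst _ _ i.+2) => //.
    exact: trm_add (trm_const 1) (trm_mul (trm_var _ i) (trm_var _ i.+1)).
  by move=> e x; rewrite /= !nthS ?eqxx /=.
apply: defn_ext (defn_or (defn_and (defn_not (dS i)) (d1 i i.+1 _))
  (defn_and (dS i) (defn_all i.+1 (defn_imp (defn_not (dS i.+1))
  (defn_imp (d1 i.+1 i _) d2))))) => [e||]; rewrite ?ne //; last by rewrite eq_sym ne.
split=> -[H|[Se H]]; [by left | right; split=> // y | by left | right; split=> // y].
  by have := H y; rewrite /= !nthS ?eqxx /=.
by rewrite /= !nthS ?eqxx /=; apply: H.
Qed.

Lemma def1_quotient S T : T 0 -> def1 S -> def1 T ->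
  def1 (fun c => forall y, ~ T y -> S (c / y)).
Proof.
move=> T0 dS dT i.
apply: defn_ext (defn_all i.+1 (defn_all i.+2 (defn_imp (defn_not (dT i.+1)) (defn_imp
  (defn_eq (trm_var _ i) (trm_mul (trm_var _ i.+2) (trm_var _ i.+1))) (dS i.+2))))) => e.
split=> [H y nT|H y z]; last first.
  rewrite /= !nthS ?eqxx /= => nT eE; have := H _ nT.
  by rewrite eE mulfK //; apply/eqP => y0; apply: nT; rewrite y0.
have y0 : y != 0 by apply/eqP => y0; apply: nT; rewrite y0.
by have := H y (e`_i / y); rewrite /= !nthS ?eqxx /= divfK //; apply.
Qed.

Lemma def1_transporter A : A 0 -> def1 A -> def1 (transporter A).
Proof. by move=> A0 dA; apply: def1_quotient. Qed.

Lemma def1_mul S a : def1 S -> def1 (fun x => S (a * x)).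
Proof.
move=> dS i; apply: (@def1_subst _ _ i.+1) => //; first exact: trm_mul (trm_const a) (trm_var _ i).
by move=> e x; rewrite /= nthS /= ne.
Qed.

Lemma def1_1B S : def1 S -> def1 (fun x => S (1 - x)).
Proof.
move=> dS i; apply: (@def1_subst _ _ i.+1) => //.
  exact: trm_add (trm_const 1) (trm_opp (trm_var _ i)).
by move=> e x; rewrite /= nthS /= ne.
Qed.

Lemma def1_conductor U : U 0 -> def1 U -> def1 (conductor U).
Proof.
move=> U0 dU i.
have d1 : defn (fun e : seq L => U (e`_i * e`_i.+1 - e`_i * e`_i.+2)).
  apply: (@def1_subst _ _ i.+3) => //.
    by apply: trm_add; [|apply: trm_opp]; apply: trm_mul; apply: trm_var.
  by move=> e x; rewrite /= !nthS ?eqxx /=.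
have d2 : defn (fun e : seq L => U (e`_i * e`_i.+1 * e`_i.+2)).
  apply: (@def1_subst _ _ i.+3) => //.
    by apply: trm_mul; [apply: trm_mul|]; apply: trm_var.
  by move=> e x; rewrite /= !nthS ?eqxx /=.
have da Q : defn Q -> defn (fun e => forall x y, U x -> U y -> Q (set_nth 0 (set_nth 0 e i.+1 x) i.+2 y)).
  move=> dQ; apply: defn_ext (defn_all i.+1 (defn_all i.+2 (defn_imp (dU i.+1) (defn_imp (dU i.+2) dQ)))) => e.
  by split=> H x y; have := H x y; rewrite /= !nthS ?eqxx /=.
apply: defn_ext (defn_and (da _ d1) (defn_and (da _ d2) (def1_quotient U0 dU dU i))) => e.
split=> [[H1 [H2 H3]]|[H1 H2 H3]].
  split=> // x y Ux Uy; [have := H1 x y Ux Uy|have := H2 x y Ux Uy];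
  by rewrite /= !nthS ?eqxx /=.
by split; [|split=> //]; move=> x y Ux Uy; rewrite /= !nthS ?eqxx /=; [apply: H1|apply: H2].
Qed.

Lemma def1_valring O S : valring O -> def1 S -> (forall c, S c <-> vmax O c) -> def1 O.
Proof.
move=> vO dS SM i.
apply: defn_ext (defn_all i.+1 (defn_imp (defn_eq (trm_mul (trm_var _ i) (trm_var _ i.+1))
  (trm_const 1)) (defn_not (dS i.+1)))) => e.
have E y : (set_nth 0 e i.+1 y)`_i * (set_nth 0 e i.+1 y)`_i.+1 = e`_i * y.
  by rewrite /= !nthS ?eqxx /=.
split=> [H|Oe y]; last first.
  rewrite E nth_set_nth /= eqxx => ey1 /SM [y0|[]].
    by move/eqP: ey1; rewrite y0 mulr0 eq_sym oner_eq0.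
  by rewrite -[y^-1]mul1r -ey1 mulfK //; apply/eqP => y0; move/eqP: ey1; rewrite y0 mulr0 eq_sym oner_eq0.
apply: contrapT => nO; have e0 : e`_i != 0 by apply/eqP => e0; apply: nO; rewrite e0; apply: vr0 vO.
apply: (H (e`_i)^-1); first by rewrite E divff.
by rewrite /= nth_set_nth /= eqxx; apply/SM/vmaxV.
Qed.

Definition has_definable_valring : Prop :=
  exists O, [/\ valring O, (exists x, ~ O x) & def1 O].

Lemma unit_group_definable O S : valring O -> mult_subgroup S ->
  (forall x, x != 0 -> O x -> O x^-1 -> S x) -> (exists2 t, t != 0 & ~ S t) -> def1 S ->
  has_definable_valring.
Proof.
move=> vO gS uS [t t0 nSt] dS; exists (unit_group_ring S); split.
- exact: unit_group_valring vO gS uS.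
- exact: unit_group_ring_proper vO gS uS t t0 nSt.
- exact: def1_unit_group_ring.
Qed.

(** * Definable rings from subgroups in positive characteristic *)

Section PrimeChar.
Context (p : nat) (pL : p \in [pchar L]).

(** In a minimal [O] with [1 - M] inside [G], either all units are in [G] and the coarsening
    applies, or there is a unit [a] outside [G]. Then [U], the intersection of [1 - G] with its
    multiple by [a^-1], lies between [M] and [O]. *)
Lemma mult_group_definable O0 G : valring O0 -> (exists x, ~ O0 x) ->
  mult_subgroup G -> (exists2 t, t != 0 & ~ G t) -> (forall x, G (x ^+ p) -> G x) ->
  (forall x, vmax O0 x -> G (1 - x)) -> def1 G -> has_definable_valring.
Proof.
move=> vO0 [x0 nOx0] gG properG Gp GM0 dG; have [G1 GM GV G0] := gG.
have Gpj j x : G (x ^+ (p ^ j)) -> G x.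
  by elim: j => [|j IH]; rewrite ?expr1 // expnSr exprM => /Gp.
have [O [vO sO MG minO]] := minimal_valring vO0 GM0.
have [unitsG|] := pselect (forall x, x != 0 -> O x -> O x^-1 -> G x).
  exact: (unit_group_definable vO gG).
move=> /existsNP[a /not_implyP[a0 /not_implyP[Oa /not_implyP[OVa nGa]]]].
pose U x := G (1 - x) /\ G (1 - a * x).
have MU x : vmax O x -> U x by move=> Mx; split; apply: MG => //; apply: (vmaxMl vO).
(* For [x] outside [O], [1 - x] and [1 - a x] agree with [- x] and [- a x] up to factors in [1 - M];
   with both in [G], the quotient [a] would be in [G]. *)
have UO x : U x -> O x.
  case=> U1 Ua; apply: contrapT => nOx; have Mx := vmaxV nOx; apply: nGa.
  have xn0 : x != 0 by apply/eqP => x_eq0; apply: nOx; rewrite x_eq0; apply: vr0 vO.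
  have G2 := MG _ Mx; have G3 := MG _ (vmaxMl vO OVa Mx).
  have := GM _ _ (GM _ _ Ua (GV _ G3)) (GV _ (GM _ _ U1 (GV _ G2))).
  have [E2 E3] : 1 - x^-1 != 0 /\ 1 - a^-1 / x != 0.
    by split; apply/eqP => E; rewrite E in G2 G3.
  congr G.
  have -> : 1 - x = - x * (1 - x^-1) by field.
  have -> : 1 - a * x = - (a * x) * (1 - a^-1 / x) by field; rewrite a0 xn0.
  by rewrite !mulfK // invrN mulrNN mulfK.
have U1 : ~ U 1 by case; rewrite subrr.
(* As [1 - x^(p^j) = (1 - x)^(p^j)] and [G] is closed under [p]-th roots, minimality with respect to
   [G] gives the minimality required for [U]. *)
have minO' O' : valring O' -> (forall x, O' x -> O x) ->
    (forall x, vmax O' x -> exists j, U (x ^+ (p ^ j))) -> forall x, O x -> O' x.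
  move=> vO' sO' MU'; apply: minO => // x /MU' [j [Gj _]]; apply: (Gpj j).
  by rewrite (frobeniusB pL) expr1n.
exists O; split=> //; first by exists x0 => /sO.
apply: def1_valring (conductor_vmax pL vO MU UO U1 minO') => //.
apply: def1_conductor; first by apply: MU; left.
have d1 := def1_1B dG.
by move=> i; apply: defn_and (d1 i) (@def1_mul (fun x => G (1 - x)) a d1 i).
Qed.

(** In a minimal [O] with [M] inside [A], either [O] lies in [A] and [transporter A] is the ring
    wanted, or some [a] in [O] is outside [A]. Such an [a] is a unit and forces [transporter A] into
    [O]. *)
Lemma add_group_definable O0 A : valring O0 -> (exists x, ~ O0 x) ->
  (forall x : L, exists y, y ^+ p = x) ->
  add_subgroup A -> (exists t, ~ A t) -> (forall x, A (x ^+ p - x)) ->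
  (forall x, vmax O0 x -> A x) -> def1 A -> has_definable_valring.
Proof.
move=> vO0 [x0 nOx0] perfL gA [t nAt] AS AM0 dA; have [A0 AB] := gA.
(* Modulo [A], every [x] is congruent to its [p]-th power. *)
have Apj j x : A (x ^+ (p ^ j)) -> A x.
  elim: j => [|j IH]; rewrite ?expr1 // expnSr exprM => Ax; apply: IH.
  by have := AB _ _ Ax (AS (x ^+ (p ^ j))); rewrite opprB addrC subrK.
have [O [vO sO MA minO]] := minimal_valring vO0 AM0.
have [OA|] := pselect (forall x, O x -> A x).
  exists (transporter A); split.
  - exact: (transporter_valring vO gA MA pL).
  - exists t => /(transporterE vO gA MA pL perfL AS OA) /(_ 1 (vr1 vO)).
    by rewrite mulr1.
  - exact: def1_transporter.
move=> /existsNP[a /not_implyP[Oa nAa]].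
have nMa : ~ vmax O a by move=> /MA.
have OVa := vrV nMa.
have a0 : a != 0 by apply/eqP => a0; apply: nAa; rewrite a0.
(* The transporter condition puts [U] inside both [O] and [A]; the condition [A (a * x)] excludes
   1. *)
pose U x := transporter A (a * x) /\ A (a * x).
have TO x : transporter A x -> O x.
  move=> Tx; apply: contrapT => nOx.
  have xn0 : x != 0 by apply/eqP => x_eq0; apply: nOx; rewrite x_eq0; apply: vr0 vO.
  apply: (not_transporter vO gA MA xn0 nAa _ _ Tx);
    by apply: (vmaxMl vO (vrX vO _ Oa)); apply: vmaxV.
have UA x : U x -> A x by case=> /(_ a nAa); rewrite mulrAC divff // mul1r.
have MU x : vmax O x -> U x.
  move=> Mx; have Max := vmaxMl vO Oa Mx; split; last exact: MA.
  exact: (vmax_transporter vO MA Max).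
have UO x : U x -> O x.
  by case=> /TO Oax _; rewrite -[x](mulKf a0); apply: (vrM vO).
have U1 : ~ U 1 by case=> _; rewrite mulr1.
have minO' O' : valring O' -> (forall x, O' x -> O x) ->
    (forall x, vmax O' x -> exists j, U (x ^+ (p ^ j))) -> forall x, O x -> O' x.
  by move=> vO' sO' MU'; apply: minO => // x /MU' [j /UA]; apply: Apj.
exists O; split=> //; first by exists x0 => /sO.
apply: def1_valring (conductor_vmax pL vO MU UO U1 minO') => //.
apply: def1_conductor; first by apply: MU; left.
by move=> i; apply: defn_and (def1_mul a (def1_transporter A0 dA) i) (def1_mul a dA i).
Qed.

End PrimeChar.

(** * Restriction to the base field *)

Lemma valring_integral O (q : {poly L}) x : valring O -> q \is monic ->
  (forall i, O q`_i) -> root q x -> O x.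
Proof.
move=> vO mq Oq /rootP qx; apply: contrapT => nOx; have My := vmaxV nOx.
have x0 : x != 0 by apply/eqP => x0; apply: nOx; rewrite x0; apply: vr0 vO.
have q0 := monic_neq0 mq.
have sz : size q = (size q).-1.+1 by rewrite prednK // size_poly_gt0.
move: qx; rewrite horner_coef sz big_ord_recr /= -[q`__]/(lead_coef q) (monicP mq) mul1r.
move=> qx; apply: (vmax1 vO).
have xn0 : x ^+ (size q).-1 != 0 by rewrite expf_neq0.
rewrite -(divff xn0) -exprVn -[x ^+ _ in X in vmax O X](addKr (\sum_(i < (size q).-1) q`_i * x ^+ i)) qx addr0.
rewrite mulNr mulr_suml; apply: (vmaxN vO); apply: (big_ind (vmax O)); first by left.
  by move=> u w; apply: (vmaxD vO).
move=> i _; rewrite -mulrA; apply: (vmaxMl vO) => //.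
rewrite (_ : x ^+ i * _ = x^-1 ^+ ((size q).-1 - i.+1).+1); first exact: vmaxX.
rewrite subnSK //; have -> : x^-1 ^+ (size q).-1 = x^-1 ^+ ((size q).-1 - i) * x^-1 ^+ i.
  by rewrite -exprD subnK // ltnW.
by rewrite mulrCA -exprMn divff // expr1n mulr1.
Qed.

Lemma definable_valring_restrict : has_definable_valring ->
  exists v : valuation K, nontrivial_valuation v /\ definable (val_ring v).
Proof.
case=> O [vO [x nOx] dO]; pose O' (a : K) := O a%:A.
have vO' : valring O'.
  split=> [|a b|a b|a]; rewrite /O'.
  - by rewrite scale1r; apply: vr1 vO.
  - by rewrite scalerBl; apply: (vrB vO).
  - by rewrite -[(a * b)%:A]/(in_alg L (a * b)) rmorphM; apply: (vrM vO).
  - by rewrite -[a^-1%:A]/(in_alg L a^-1) fmorphV; apply: (vr_total vO).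
exists (valring_valuation vO'); split.
  move=> triv; apply: nOx.
  apply: (valring_integral vO (monic_minPoly 1 x) _ (root_minPoly 1 x)) => i.
  have /vlineP[a ->] : (minPoly 1 x)`_i \in 1%VS by apply/polyOverP/minPolyOver.
  by have := triv a; rewrite valring_valuationE => /asboolP.
have [f Hf] := def1_scalar dO; exists f => a.
by rewrite -Hf valring_valuationE; split=> /asboolP.
Qed.

End DefinableRings.

(** * Value group and residue field *)

Section ValuationLemmas.
Context (K : fieldType) (v : valuation K).
Local Notation Gamma := (val_codom v).

Let vtot : total (<=%R : rel Gamma) := (val_codom_ordered v).1.
Let vleD := (val_codom_ordered v).2.

Lemma val_inv x g : x != 0 -> v x = Some g -> v x^-1 = Some (- g).
Proof.
move=> x0 xg; have := val_mul v x x^-1; rewrite divff // Defs.val1 xg.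
case: (v x^-1) => //= h [] /esym/eqP.
by rewrite addrC addr_eq0 => /eqP->.
Qed.

Lemma valX x g n : v x = Some g -> v (x ^+ n) = Some (g *+ n).
Proof.
move=> xg; elim: n => [|n IH]; first by rewrite expr0 Defs.val1 mulr0n.
by rewrite exprS val_mul xg IH /= mulrS.
Qed.

Lemma val_ring_valring : valring (fun x : K => x \in val_ring v).
Proof.
have [r1 rB rM] := val_ring_subring v; split=> // x.
have [->|x0] := eqVneq x 0; first by left; rewrite inE val0.
have [g xg] := val_nz v x0; rewrite !inE (val_inv x0 xg) xg /=.
case/orP: (vtot 0 g) => H; [by left | right].
by have := vleD (- g) H; rewrite addr0 addNr.
Qed.

Lemma val_unit x : x != 0 -> x \in val_ring v -> x^-1 \in val_ring v -> v x = Some 0.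
Proof.
move=> x0; have [g xg] := val_nz v x0; rewrite !inE (val_inv x0 xg) xg /= => g0 g0'.
congr Some; apply/le_anti; rewrite g0 andbT.
by have := vleD g g0'; rewrite addr0 addrN.
Qed.

Lemma val_ring_total (x : K) : exists a : val_ring_type v, x = val a \/ x^-1 = val a.
Proof.
case: (vr_total val_ring_valring x) => H; exists (ValRing H); first by left.
by right.
Qed.

Lemma residue_surj (c : residue_field v) : exists a, \pi_(residue_field v) a = c.
Proof. by exists (generic_quotient.repr c); rewrite reprK. Qed.

Lemma residue_unit (a : val_ring_type v) : \pi_(residue_field v) a != 0 ->
  exists c, a * c = 1.
Proof.
move=> pa0; have aP : val a \notin val_ideal v.
  apply: contra pa0 => aP; rewrite -(rmorph0 (\pi_(residue_field v))).
  by rewrite -Quotient.idealrBE subr0.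
have a0 : val a != 0.
  by apply: contraNneq pa0 => a0; rewrite (_ : a = 0) ?rmorph0 //; apply: val_inj.
exists (ValRing (val_ring_inv (valP a) aP)); apply: val_inj.
by rewrite rmorphM rmorph1 /= divff.
Qed.

(** The subgroup consists of the units of [v] times the [n]-th powers; an element whose value is not
    [n] times a value lies outside it. [K^o] is [K] as an extension of itself. *)
Lemma not_divisible_definable :
  (forall n, (0 < n)%N -> finite_index *%R (@mult_group K^o) (@mult_powers K^o n)) ->
  ~ divisible_value_group v -> has_definable_valring K^o.
Proof.
move=> fin /existsNP[n /not_implyP[n0 /existsNP[g /not_implyP[[x x0 xg] ndiv]]]].
pose O (x : K^o) : Prop := (x : K) \in val_ring v.
have vO : valring O := val_ring_valring.
pose S (x : K^o) := exists u y : K^o, [/\ u != 0, O u, O u^-1, y != 0 & x = u * y ^+ n].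
have S1 : forall y : K^o, y != 0 -> S (y ^+ n).
  move=> y y0; exists 1, y; rewrite invr1 mul1r oner_neq0; split=> //; exact: vr1 vO.
have gS : mult_subgroup S.
  split=> [|a b|a|].
  + by rewrite -(expr1n _ n); apply: S1; rewrite oner_neq0.
  + case=> u [y [u0 Ou OVu y0 ->]] [w [z [w0 Ow OVw z0 ->]]].
    exists (u * w), (y * z); rewrite !mulf_neq0 // exprMn mulrACA invfM.
    by split=> //; apply: (vrM vO).
  + case=> u [y [u0 Ou OVu y0 ->]]; exists u^-1, y^-1.
    by rewrite !invr_eq0 invrK exprVn invfM.
  + by case=> u [y [u0 Ou OVu y0 /esym/eqP]]; rewrite mulf_eq0 expf_eq0 (negPf u0) (negPf y0) andbF.
apply: (unit_group_definable vO gS).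
- move=> u u0 Ou OVu; exists u, 1; rewrite expr1n mulr1 oner_neq0; split=> //.
- exists x => // -[u [y [u0 Ou OVu y0 xE]]]; apply: ndiv.
  have [h yh] := val_nz v y0; exists h; first by exists y.
  move: xg; rewrite xE val_mul (val_unit u0 Ou OVu) (valX n yh) /= add0r.
  by case.
- exact: def1_mult_cosets gS S1 (fin n n0).
Qed.

End ValuationLemmas.

(** If [x] is not a [p]-th power, no [x + t^p] vanishes, and among infinitely many [t] two fall in
    one coset: [x + s^p = (x + t^p) u^p] with [s <> t]. Then [x (1 - u^p) = (t u - s)^p]; here
    [u^p = 1] would give [s = t], so [x] is a [p]-th power after all. *)
Lemma finite_index_perfect (L : fieldType) (p : nat) : p \in [pchar L] ->
  (exists f : nat -> L, injective f) ->
  finite_index *%R (@mult_group L) (@mult_powers L p) ->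
  forall x : L, exists y, y ^+ p = x.
Proof.
move=> pL [f finj] [s [s0 cov]] x; apply: contrapT => nx.
have nz (t : L) : x + t ^+ p != 0.
  apply/eqP => /eqP; rewrite addr_eq0 => /eqP xE; apply: nx; exists (- t).
  by rewrite -[p]expn1 -[- t]sub0r (frobeniusB pL) expn1 expr0n gtn_eqF ?(pchar_gt0 pL) // sub0r.
have /choice [g gP] i : exists a, a \in s /\ exists y, y != 0 /\ x + f i ^+ p = a * y ^+ p.
  have [a as_ [h [y y0 hE] E]] := cov _ (nz (f i)).
  by exists a; split=> //; exists y; rewrite E hE.
have [i [j [ij gij]]] : exists i j, i != j /\ g i = g j.
  apply: contrapT => H; have ginj : injective g.
    by move=> i j gij; apply/eqP; apply: contraT => ij; case: H; exists i, j.
  have := uniq_leq_size (_ : uniq (map g (iota 0 (size s).+1))) (_ : {subset _ <= s}).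
  rewrite size_map size_iota ltnn => C; suff: false by []; apply: C.
    by rewrite map_inj_uniq ?iota_uniq.
  by move=> _ /mapP[k _ ->]; case: (gP k).
have [_ [y [y0 yE]]] := gP i; have [_ [z [z0 zE]]] := gP j.
have [as_ _] := gP i; have a0 := s0 _ as_; rewrite -gij in zE.
pose u := y / z; have uE : x + f i ^+ p = (x + f j ^+ p) * u ^+ p.
  rewrite yE zE /u exprMn exprVn -!mulrA; congr (_ * _).
  by rewrite mulrC divfK // expf_neq0.
have powB (a c : L) : (a - c) ^+ p = a ^+ p - c ^+ p.
  by have := frobeniusB pL 1 a c; rewrite expn1.
have [u1|u1] := eqVneq (u ^+ p) 1.
  move: uE; rewrite u1 mulr1 => /addrI /eqP; rewrite -subr_eq0 -powB.
  rewrite expf_eq0 (pchar_gt0 pL) subr_eq0 => /eqP /finj /eqP.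
  by rewrite (negPf ij).
apply: nx; exists ((f j * u - f i) / (1 - u)).
have u1' : 1 - u ^+ p != 0 by rewrite subr_eq0 eq_sym.
rewrite exprMn exprVn !powB exprMn expr1n.
apply: (mulIf u1'); rewrite divfK // mulrBr mulr1.
apply/eqP; rewrite -subr_eq0; apply/eqP.
rewrite (_ : _ - _ = (x + f j ^+ p) * u ^+ p - (x + f i ^+ p)); last by ring.
by rewrite -uE subrr.
Qed.

Lemma valring_infinite (L : fieldType) (O : L -> Prop) : valring O -> (exists x, ~ O x) ->
  exists f : nat -> L, injective f.
Proof.
move=> vO [x nOx]; have x0 : x != 0 by apply/eqP => x0; apply: nOx; rewrite x0; apply: vr0 vO.
exists (fun n => x ^+ n) => i j; wlog ij : i j / (i <= j)%N => [H|] /=.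
  by case/orP: (leq_total i j) => ij H'; [apply: H | apply/esym/H].
move/eqP; rewrite -(subnK ij) exprD -{1}[x ^+ i]mul1r => /eqP /(mulIf (expf_neq0 i x0)).
case: (j - i)%N => [|n] //= H.
by case: nOx; apply: (vr_root vO (n := n)); rewrite -H; apply: vr1 vO.
Qed.

(** * Unramified extensions *)

(* [A] is a valuation ring of [K] with residue field [k], given abstractly by  *)
(* the inclusion [iota] and the residue map [pi]. The extension [E] of [k]     *)
(* generated by [b] is lifted to the unramified extension [K(z)] of [K], where *)
(* [z] is a root of a monic lift to [A] of the minimal polynomial of [b].      *)
Section UnramifiedLift.
Context (A : comNzRingType) (K k : fieldType).
Context (iota : {rmorphism A -> K}) (pi : {rmorphism A -> k}).
Hypothesis iota_inj : injective iota.
Hypothesis iota_total : forall x : K, exists a, x = iota a \/ x^-1 = iota a.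
Hypothesis pi_surj : forall c : k, exists a, pi a = c.
Hypothesis pi_unit : forall a, pi a != 0 -> exists c, a * c = 1.

Lemma common_divisor (s : seq K) : has (fun x => x != 0) s ->
  exists2 c, c \in s & c != 0 /\ forall x, x \in s -> exists a, x / c = iota a.
Proof.
elim: s => //= x s IH; have [/IH [c cs [c0 H]] _|s0] := boolP (has _ s); last first.
  rewrite orbF => x0; exists x; rewrite ?mem_head //; split=> // y.
  rewrite inE => /predU1P[->|ys]; first by exists 1; rewrite divff // rmorph1.
  by exists 0; move/hasPn: s0 => /(_ y ys); rewrite negbK rmorph0 => /eqP->; rewrite mul0r.
have [a [E|E]] := iota_total (x / c).
  exists c; rewrite ?inE ?cs ?orbT //; split=> // y; rewrite inE => /predU1P[->|/H//].
  by exists a.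
have [x0|x0] := eqVneq x 0.
  exists c; rewrite ?inE ?cs ?orbT //; split=> // y; rewrite inE => /predU1P[->|/H//].
  by exists 0; rewrite x0 mul0r rmorph0.
exists x; rewrite ?mem_head //; split=> // y; rewrite inE => /predU1P[->|/H [e Ee]].
  by exists 1; rewrite divff // rmorph1.
by exists (e * a); rewrite rmorphM -Ee -E invf_div mulrA divfK.
Qed.

(** Dividing by a coefficient of least value leaves coefficients in [A], one of them equal to 1, so
    the reduction does not vanish. *)
Lemma primitive_factor (Q : {poly K}) : Q != 0 ->
  exists (c : K) (P : {poly A}),
    [/\ c != 0, Q = c *: map_poly iota P, map_poly pi P != 0 & size P = size Q].
Proof.
move=> Q0; have : has (fun x => x != 0) Q.
  by apply/hasP; exists (lead_coef Q); rewrite ?lead_coef_eq0 // mem_nth // prednK // size_poly_gt0.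
case/common_divisor=> c /(nthP 0) [j jQ Qj] [c0 H].
have /choice [a aE] i : exists a, Q`_i / c = iota a.
  have [iQ|iQ] := ltnP i (size Q); first by apply: H; rewrite mem_nth.
  by exists 0; rewrite nth_default // mul0r rmorph0.
pose P := \poly_(i < size Q) a i.
have QE : Q = c *: map_poly iota P.
  apply/polyP => i; rewrite coefZ coef_map coef_poly; case: ltnP => iQ.
    by rewrite /= -aE mulrCA divff // mulr1.
  by rewrite /= rmorph0 mulr0 nth_default.
exists c, P; split=> //; last by rewrite QE size_scale // size_map_inj_poly ?rmorph0.
apply/eqP => /polyP /(_ j); rewrite coef_map coef_poly jQ coef0 /= => paj.
have aj1 : a j = 1 by apply: iota_inj; rewrite -aE Qj divff // rmorph1.
by move/eqP: paj; rewrite /= aj1 rmorph1 oner_eq0.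
Qed.

Section Extension.
Context (E : fieldExtType k) (b : E).
Let rho (P : {poly A}) : E := (map_poly (in_alg E) (map_poly pi P)).[b].

Let rhoD : {morph rho : P Q / P + Q}.
Proof. by move=> P Q; rewrite /rho !rmorphD hornerD. Qed.
Let rhoB : {morph rho : P Q / P - Q}.
Proof. by move=> P Q; rewrite /rho !rmorphB hornerD hornerN. Qed.
Let rhoM : {morph rho : P Q / P * Q}.
Proof. by move=> P Q; rewrite /rho !rmorphM hornerM. Qed.
Let rhoC a : rho a%:P = (pi a)%:A.
Proof. by rewrite /rho !map_polyC hornerC. Qed.
Let rhoX : rho 'X = b. Proof. by rewrite /rho !map_polyX hornerX. Qed.

Lemma lift_minPoly : exists f : {poly A},
  [/\ f \is monic, rho f = 0, (1 < size f)%N &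
    forall q : {poly k}, q != 0 -> (size q < size f)%N ->
      (map_poly (in_alg E) q).[b] != 0].
Proof.
have /polyOver1P [g gE] := minPolyOver 1 b.
have mg : g \is monic by have := monic_minPoly 1 b; rewrite gE map_monic.
have /choice [l lE] := pi_surj.
pose n := (size g).-1.
have szg : size g = n.+1 by rewrite prednK // size_poly_gt0 monic_neq0.
pose f : {poly A} := 'X^n + \poly_(i < n) l g`_i.
have szf : size f = n.+1.
  by rewrite size_polyDl size_polyXn // ltnS size_poly.
have mf : f \is monic.
  apply/monicP; rewrite lead_coefDl ?lead_coefXn // size_polyXn ltnS.
  exact: size_poly.
have fg : map_poly pi f = g.
  apply/polyP => i; rewrite coef_map coefD coefXn coef_poly /= rmorphD rmorph_nat.
  case: ltnP => /= [lt|]; first by rewrite ltn_eqF // add0r lE.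
  rewrite leq_eqVlt rmorph0 addr0 => /predU1P[<-|gt].
    by rewrite eqxx -(monicP mg) lead_coefE.
  by rewrite gtn_eqF // nth_default // szg.
exists f; split=> //.
- by rewrite /rho fg -gE; apply/eqP/root_minPoly.
- by have := size_minPoly 1 b; rewrite gE size_map_poly szg szf => ->; rewrite ltnS adjoin_degreeE dimv1 divn1 adim_gt0.
move=> q q0 szq; apply: contraL szq => qb; rewrite -leqNgt szf -szg.
have dvd : minPoly 1 b %| map_poly (in_alg E) q.
  by apply: minPoly_dvdp; [apply/polyOver1P; exists q | rewrite rootE qb].
have := dvdp_leq _ dvd; rewrite gE !size_map_poly; apply.
by rewrite map_poly_eq0.
Qed.

Section Root.
Context (f : {poly A}) (mf : f \is monic) (rhof : rho f = 0) (szf : (1 < size f)%N).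
Hypothesis minf : forall q : {poly k}, q != 0 -> (size q < size f)%N ->
  (map_poly (in_alg E) q).[b] != 0.

Let F := map_poly iota f.
Let szF : size F = size f. Proof. by rewrite size_map_inj_poly ?rmorph0. Qed.
Let F0 : F != 0. Proof. by rewrite -size_poly_gt0 szF ltnW. Qed.

Let rho_neq0 P : map_poly pi P != 0 -> (size P < size f)%N -> rho P != 0.
Proof. by move=> P0 szP; apply: minf => //; apply: leq_ltn_trans (size_poly _ _) szP. Qed.

(** Gauss's lemma: the primitive parts [R], [P] of two factors of smaller degree have nonzero
    reductions at [b], by minimality of [f]. But [f = a R P] or [a f = R P] with [a] in [A], where
    in the first case [pi a] is nonzero because [f] is monic; either way [rho f = 0] gives
    [rho (R P) = 0]. *)
Lemma lift_irreducible : irreducible_poly F.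
Proof.
split=> [|q q1 /dvdpP [r rE]]; first by rewrite szF.
have q0 : q != 0 by apply: contra_neq F0 => q0; rewrite rE q0 mulr0.
have r0 : r != 0 by apply: contra_neq F0 => r0; rewrite rE r0 mul0r.
have szE : size F = (size r + size q).-1 by rewrite rE size_mul.
have q_gt0 : (0 < size q)%N by rewrite size_poly_gt0.
have r_gt0 : (0 < size r)%N by rewrite size_poly_gt0.
rewrite -dvdp_size_eqp; last by rewrite rE dvdp_mull.
apply: contraT => neq.
have ltq : (size q < size f)%N by rewrite -szF szE; move: neq; rewrite szE; lia.
have ltr : (size r < size f)%N by rewrite -szF szE; lia.
have [c [P [c0 qE P0 szP]]] := primitive_factor q0.
have [e [R [e0 RE R0 szR]]] := primitive_factor r0.
have FE : F = (e * c) *: map_poly iota (R * P).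
  by rewrite rE qE RE rmorphM -scalerAl -scalerAr scalerA.
have : rho R * rho P != 0 by rewrite mulf_neq0 // rho_neq0 ?szR ?szP.
rewrite -rhoM => /negP[]; apply/eqP.
have [a [ecE|ecE]] := iota_total (e * c).
  have fE : f = a%:P * (R * P).
    apply: (map_inj_poly iota_inj (rmorph0 _)).
    by rewrite [LHS]FE ecE [in RHS]rmorphM /= map_polyC mul_polyC.
  have [pa0|pa0] := eqVneq (pi a) 0; last first.
    move: rhof; rewrite fE rhoM rhoC => /eqP; rewrite mulf_eq0 => /orP[|/eqP//].
    by rewrite scaler_eq0 oner_eq0 orbF (negPf pa0).
  have := congr1 (map_poly pi) fE; rewrite rmorphM /= map_polyC /= pa0 polyC0 mul0r.
  move=> /polyP /(_ (size f).-1); rewrite coef_map /= -lead_coefE (monicP mf) rmorph1 coef0.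
  by move/eqP; rewrite oner_eq0.
have fE : a%:P * f = R * P.
  apply: (map_inj_poly iota_inj (rmorph0 _)).
  by rewrite rmorphM /= map_polyC /= -/F FE -ecE mul_polyC scalerA mulVf ?scale1r ?mulf_neq0.
by rewrite -fE rhoM rhof mulr0.
Qed.

Section Lift.
Context (L : fieldExtType K) (z : L) (Fz : root (map_poly (in_alg L) F) z).
Hypothesis genz : <<1; z>>%VS = fullv.

Let j (P : {poly A}) : L := (map_poly (in_alg L) (map_poly iota P)).[z].

Let jB : {morph j : P Q / P - Q}.
Proof. by move=> P Q; rewrite /j !rmorphB hornerD hornerN. Qed.
Let jD : {morph j : P Q / P + Q}.
Proof. by move=> P Q; rewrite /j !rmorphD hornerD. Qed.
Let jM : {morph j : P Q / P * Q}.
Proof. by move=> P Q; rewrite /j !rmorphM hornerM. Qed.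
Let jC a : j a%:P = (iota a)%:A.
Proof. by rewrite /j !map_polyC hornerC. Qed.
Let jX : j 'X = z. Proof. by rewrite /j !map_polyX hornerX. Qed.

Let small_root (Q : {poly K}) : (size Q < size F)%N ->
  (map_poly (in_alg L) Q).[z] = 0 -> Q = 0.
Proof.
move=> szQ Qz; apply/eqP; apply: contraT => Q0.
have cop : coprimep F Q.
  rewrite coprimep_def; have [_ irr] := lift_irreducible.
  apply: contraLR szQ => g1; rewrite -leqNgt.
  rewrite -(eqp_size (irr _ g1 (dvdp_gcdl F Q))).
  by apply: dvdp_leq => //; apply: dvdp_gcdr.
rewrite -(coprimep_map (in_alg L)) in cop.
by have /(_ z Fz) := coprimep_root cop; rewrite Qz eqxx.
Qed.

(** Division by the monic [f] over [A] leaves a remainder of smaller degree vanishing at [z], hence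
    zero. Thus sending [j P] to [rho P] is a well-defined residue map. *)
Let rho0 P : j P = 0 -> rho P = 0.
Proof.
move=> jP; have PE := Pdiv.RingMonic.rdivp_eq mf P.
have jf : j f = 0 by apply/rootP.
have szr : (size (Pdiv.Ring.rmodp P f) < size f)%N.
  by rewrite Pdiv.Ring.ltn_rmodp monic_neq0.
have r0 : Pdiv.Ring.rmodp P f = 0.
  apply: (map_inj_poly iota_inj (rmorph0 _)); rewrite rmorph0.
  apply: small_root; first by rewrite szF size_map_inj_poly ?rmorph0.
  by move: jP; rewrite {1}PE jD jM jf mulr0 add0r.
by rewrite PE r0 addr0 rhoM rhof mulr0.
Qed.

Let rho_j P Q : j P = j Q -> rho P = rho Q.
Proof. by move=> /eqP; rewrite -subr_eq0 -jB => /eqP /rho0 /eqP; rewrite rhoB subr_eq0 => /eqP. Qed.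

(** This expresses unramifiedness: up to a scalar of [K], every nonzero [x] is a unit of the ring
    [Ow] below, by [Ow_unit]. *)
Let primitive_form x : x != 0 -> exists c P, [/\ c != 0, x = c%:A * j P & rho P != 0].
Proof.
move=> x0; have /Fadjoin_polyP [q /polyOver1P [Q ->] xE] : x \in <<1; z>>%VS by rewrite genz memvf.
have xE' : x = (map_poly (in_alg L) (Q %% F)).[z].
  rewrite xE {1}(divp_eq Q F) rmorphD rmorphM hornerD hornerM.
  by rewrite (rootP Fz) mulr0 add0r.
have Q0 : Q %% F != 0.
  by apply: contra_neq x0 => Q0; rewrite xE' Q0 rmorph0 horner0.
have [c [P [c0 QE P0 szP]]] := primitive_factor Q0.
exists c, P; split=> //; last by apply: rho_neq0; rewrite // szP -szF ltn_modp.
by rewrite xE' QE linearZ /= hornerZ mulr_algl.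
Qed.

Let pi_iota c a : c^-1 = iota a -> pi a != 0 -> exists a', c = iota a'.
Proof.
move=> cE /pi_unit [a' aa']; exists a'.
have := congr1 iota aa'; rewrite rmorphM rmorph1 -cE => H.
have c0 : c != 0 by apply/eqP => c0; move/eqP: H; rewrite c0 invr0 mul0r eq_sym oner_eq0.
by rewrite -[RHS](mulKf (invr_neq0 c0)) H invrK mulr1.
Qed.

Let Ow (x : L) := exists P, x = j P.

Let OwC a : Ow (iota a)%:A. Proof. by exists a%:P; rewrite jC. Qed.

Let OwM x y : Ow x -> Ow y -> Ow (x * y).
Proof. by case=> P -> [Q ->]; exists (P * Q); rewrite jM. Qed.

Let Owj P : Ow (j P). Proof. by exists P. Qed.

Let unit_scalar e Q : e%:A * j Q = 1 -> rho Q != 0 -> exists a, e = iota a.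
Proof.
move=> eQ Q0; have e0 : e != 0.
  by apply/eqP => e0; move/eqP: eQ; rewrite e0 scale0r mul0r eq_sym oner_eq0.
have [a [->|aE]] := iota_total e; first by exists a.
apply: (pi_iota aE); have : rho a%:P = rho Q.
  apply: rho_j; rewrite jC -aE -[_^-1%:A]/(in_alg L _^-1) fmorphV /=.
  have eA0 : e%:A != 0 :> L by rewrite scaler_eq0 oner_eq0 orbF.
  by apply: (mulfI eA0); rewrite divff // eQ.
rewrite rhoC => H; apply/eqP => pa0; move/eqP: Q0; apply.
by rewrite -H pa0 scale0r.
Qed.

Let Ow_valring : valring Ow.
Proof.
split=> [|x y [P ->] [Q ->]|x y|x].
- by exists 1; rewrite /j !rmorph1 hornerC.
- by exists (P - Q); rewrite jB.
- exact: OwM.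
have [->|x0] := eqVneq x 0; first by left; exists 0; rewrite /j !rmorph0 horner0.
have [c [P [c0 xE P0]]] := primitive_form x0.
have [c' [P' [c0' xE' P0']]] := primitive_form (invr_neq0 x0).
have cE : (c * c')%:A * j (P * P') = 1.
  rewrite jM -[_%:A]/(in_alg L _) rmorphM /= mulrACA -xE -xE'.
  exact: divff.
have [|e eE] := unit_scalar cE; first by rewrite rhoM mulf_neq0.
(* The product [c c'] is in [A]; so if [c^-1] is in [A], then so is [c' = c^-1 (c c')]. *)
have [a [aE|aE]] := iota_total c; [left; rewrite xE aE | right; rewrite xE'].
  exact: OwM (OwC a) (Owj P).
have -> : c' = iota (a * e) by rewrite rmorphM -aE -eE mulKf.
exact: OwM (OwC _) (Owj _).
Qed.

Let Ow_unit P : rho P != 0 -> Ow (j P)^-1.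
Proof.
move=> P0; have jP0 : j P != 0 by apply: contra_neq P0; apply: rho0.
have [c [Q [c0 xE Q0]]] := primitive_form (invr_neq0 jP0).
have cE : c%:A * j (Q * P) = 1 by rewrite jM mulrA -xE mulVf.
have [|e eE] := unit_scalar cE; first by rewrite rhoM mulf_neq0.
by rewrite xE eE; apply: OwM (OwC e) (Owj Q).
Qed.

Lemma unramified_lift_root : exists (O : L -> Prop) (res : L -> E),
  [/\ valring O, (forall t : K, (forall a, t <> iota a) -> ~ O t%:A),
    [/\ res 1 = 1, forall x y, O x -> O y -> res (x + y) = res x + res y &
        forall x y, O x -> O y -> res (x * y) = res x * res y],
    forall x, O x -> (vmax O x <-> res x = 0) & O z /\ res z = b].
Proof.
(* The value is independent of [P] by [rho_j]; outside [Ow] it is the default 0. *)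
have /choice [res resE] x : exists y, forall P, x = j P -> y = rho P.
  have [[P ->]|nO] := pselect (Ow x); first by exists (rho P) => Q /rho_j.
  by exists 0 => P xE; case: nO; exists P.
have resj P : res (j P) = rho P by apply: resE.
have rho1 : rho 1 = 1 by rewrite /rho !rmorph1 hornerC.
have j1 : j 1 = 1 by rewrite /j !rmorph1 hornerC.
exists Ow, res; split.
- exact: Ow_valring.
- move=> t nt [P tE]; have [a [ta|ta]] := iota_total t; first exact: nt ta.
  have t0 : t != 0 by apply/eqP => t0; apply: (nt 0); rewrite rmorph0.
  have [pa0|pa0] := eqVneq (pi a) 0; last by have [a' /nt] := pi_iota ta pa0.
  have : j 1 = j (a%:P * P).
    by rewrite jM jC -ta -tE -[RHS](rmorphM (in_alg L)) mulVf // rmorph1.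
  move/rho_j/eqP; rewrite rhoM rhoC pa0 scale0r mul0r rho1.
  by rewrite oner_eq0.
- split=> [|x y [P ->] [Q ->]|x y [P ->] [Q ->]]; first by rewrite -j1 resj.
    by rewrite -jD !resj rhoD.
  by rewrite -jM !resj rhoM.
- move=> x [P xE]; rewrite xE resj; split=> [[jP0|nO]|P0]; first exact: rho0.
    by apply/eqP; apply: contraT => /Ow_unit.
  have [->|jP0] := eqVneq (j P) 0; [by left | right=> -[Q QE]].
  have : rho (P * Q) = rho 1 by apply: rho_j; rewrite jM -QE divff.
  by rewrite rhoM P0 mul0r rho1 => /eqP; rewrite eq_sym oner_eq0.
- by rewrite -jX resj rhoX; split; [exists 'X|].
Qed.

End Lift.
End Root.

(** The clause on [t] says that [O] meets [K] inside [A]; through it, a proper [A] gives a proper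
    [O]. *)
Lemma unramified_lift : exists (L : fieldExtType K) (O : L -> Prop) (res : L -> E),
  [/\ valring O, (forall t : K, (forall a, t <> iota a) -> ~ O t%:A),
    [/\ res 1 = 1, forall x y, O x -> O y -> res (x + y) = res x + res y &
        forall x y, O x -> O y -> res (x * y) = res x * res y],
    forall x, O x -> (vmax O x <-> res x = 0) & exists2 z, O z & res z = b].
Proof.
have [f [mf f0 szf minf]] := lift_minPoly.
have [L _ [z Fz genz]] := irredp_FAdjoin (lift_irreducible mf f0 szf minf).
have [O [res [vO nO resM kerres [Oz rz]]]] := unramified_lift_root mf f0 szf minf Fz genz.
by exists L, O, res; split=> //; exists z.
Qed.

End Extension.
End UnramifiedLift.

(** * Radical-closed fields of positive characteristic *)

Lemma irreducible_factor (F : fieldType) (g : {poly F}) : (1 < size g)%N ->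
  exists2 r, irreducible_poly r & r %| g.
Proof.
move=> g1; pose P (n : nat) := `[< exists r : {poly F}, [/\ size r = n, (1 < n)%N & (r %| g)%R] >].
have exP : exists n, P n by exists (size g); apply/asboolP; exists g.
case: (ex_minnP exP) => n /asboolP [r [szr n1 rg]] minn.
exists r => //; split=> [|q q1 qr]; first by rewrite szr.
have r0 : r != 0 by rewrite -size_poly_gt0 szr ltnW.
have q0 : q != 0 by apply: contra_neq r0 => q0; apply/eqP; rewrite -dvd0p -q0.
rewrite -dvdp_size_eqp // eqn_leq dvdp_leq //= szr; apply: minn; apply/asboolP.
by exists q; rewrite (dvdp_trans qr) // ltn_neqAle eq_sym q1 size_poly_gt0.
Qed.

Lemma splitting_extension (F : fieldType) (g : {poly F}) : g != 0 ->
  exists (E : fieldExtType F) (zs : seq E),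
    map_poly (in_alg E) g %= \prod_(z <- zs) ('X - z%:P).
Proof.
move: {2}_.+1 (ltnSn (size g)) => n; elim: n => // n IH in F g * => szg g0.
have [g1|g1] := leqP (size g) 1.
  by exists F^o, [::]; rewrite big_nil -size_poly_eq1 size_map_poly eqn_leq g1 size_poly_gt0.
have [r irr rg] := irreducible_factor g1.
have [K _ [x rx _]] := irredp_FAdjoin irr.
have /factor_theorem [q gE] : root (map_poly (in_alg K) g) x.
  by rewrite -(divpK rg) rmorphM rootM rx orbT.
have q0 : q != 0.
  by move: g0; rewrite -(map_poly_eq0 (in_alg K)) gE mulf_eq0 => /norP[].
have [|L [zs qE]] := IH K q _ q0.
  have := size_map_poly (in_alg K) g; rewrite gE size_mul ?polyXsubC_eq0 // size_XsubC addn2 /=.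
  by move=> szE; rewrite -ltnS szE.
exists (baseFieldType L), (x%:A :: zs).
rewrite big_cons (_ : map_poly _ g = map_poly (in_alg L) (map_poly (in_alg K) g)).
  by rewrite gE rmorphM rmorphB /= map_polyX map_polyC mulrC /= eqp_mull.
rewrite -map_poly_comp; apply: eq_map_poly => a /=.
exact: baseField_scaleE.
Qed.

Lemma splitting_field_exists (F : fieldType) (g : {poly F}) : g != 0 ->
  exists E : splittingFieldType F, splittingFieldFor 1 (map_poly (in_alg E) g) {:E}.
Proof.
move=> /splitting_extension [L [ys gE]]; pose E : fieldExtType F := subvs_of <<1 & ys>>.
have [zs zsE] : exists zs : seq E, map val zs = ys.
  exists (map (vsproj <<1 & ys>>) ys); rewrite -map_comp map_id_in // => y ys_y /=.
  by rewrite vsprojK // seqv_sub_adjoin.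
have spl : splittingFieldFor 1 (map_poly (in_alg E) g) {:E}.
  exists zs.
    rewrite -(eqp_map (vsval : {rmorphism E -> L})) -map_poly_comp rmorph_prod /=.
    rewrite (_ : map_poly _ g = map_poly (in_alg L) g); last first.
      by apply: eq_map_poly => a; apply: rmorph_alg.
    have prodE : \prod_(z <- map val zs) ('X - z%:P) =
        \prod_(z <- zs) map_poly (vsval : {rmorphism E -> L}) ('X - z%:P).
      by rewrite big_map; apply: eq_bigr => z _; rewrite rmorphB /= map_polyX map_polyC.
    by rewrite zsE in prodE; rewrite -prodE.
  apply/vspaceP => u; rewrite memvf.
  have : val u \in (linfun (vsval : E -> L) @: <<1 & zs>>)%VS.
    have mapE : map (linfun (vsval : E -> L)) zs = ys.
      by apply: etrans zsE; apply: eq_map => z; rewrite lfunE.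
    by rewrite aimg_adjoin_seq aimg1 mapE (valP u).
  by case/memv_imgP => w zs_w; rewrite lfunE => /val_inj ->.
have ax : splitting_field_axiom E.
  by exists (map_poly (in_alg E) g); first exact: (alg_polyOver 1%AS).
pose S : splittingFieldType F :=
  HB.pack (FieldExt.sort E) (FieldExt_isSplittingField.Build F E ax).
by exists S.
Qed.

Section Radicals.
Context (k : fieldType) (p : nat) (pk : p \in [pchar k]).
Hypothesis rad : forall (E : fieldExtType k) (b : E) q, prime q -> exists c, c ^+ q = b.
Hypothesis artin_schreier : forall (E : fieldExtType k) (b : E), exists c, c ^+ p - c = b.

Let geom (l : nat) : {poly k} := \sum_(i < l) 'X^i.

Let geom_size l : (0 < l)%N -> size (geom l) = l.
Proof.
move=> l0; rewrite /geom -(prednK l0) big_ord_recr /= addrC.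
rewrite size_polyDl ?size_polyXn // ltnS; apply: (leq_trans (size_sum _ _ _)).
by apply/bigmax_leqP => i _; rewrite size_polyXn ltn_ord.
Qed.

Let geomE (E : fieldExtType k) (u : E) l :
  (map_poly (in_alg E) (geom l)).[u] = \sum_(i < l) u ^+ i.
Proof.
by rewrite rmorph_sum horner_sum; apply: eq_bigr => i _; rewrite /= map_polyXn hornerXn.
Qed.

Section SplittingField.
Context (E : splittingFieldType k).

Let pE : p \in [pchar E]. Proof. by rewrite pchar_lalg. Qed.

Let subfield_rad (M : {subfield E}) b q : prime q -> b \in M ->
  exists2 c, c \in M & c ^+ q = b.
Proof.
move=> pq bM; have [c cE] := rad (vsproj M b) pq.
by exists (vsval c); rewrite ?subvsP // -(rmorphXn vsval) cE /= vsprojK.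
Qed.

Let subfield_as (M : {subfield E}) b : b \in M -> exists2 c, c \in M & c ^+ p - c = b.
Proof.
move=> bM; have [c cE] := artin_schreier (vsproj M b).
by exists (vsval c); rewrite ?subvsP // -(rmorphXn vsval) -rmorphB cE /= vsprojK.
Qed.

(** The subfield [k(y^p)] contains a [p]-th root of [y^p], which is [y] by injectivity of Frobenius;
    hence [y] is separable. *)
Lemma radicals_galois : galois 1 {:E}.
Proof.
apply/and3P; split; [exact: sub1v | | exact: normalFieldf].
apply/separableP => y _; rewrite (pcharf_p_separable 1 y 0 pE) expn1.
have [c cM cE] := subfield_rad (pcharf_prime pE) (memv_adjoin 1%AS (y ^+ p)).
suff yc : y = c by rewrite {1}yc.
apply/eqP; rewrite -subr_eq0.
have := frobeniusB pE 1 y c; rewrite expn1 => H.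
have : (y - c) ^+ p == 0 by rewrite H cE subrr.
by rewrite expf_eq0 => /andP[].
Qed.

Context (g : gal_of {:E}) (l : nat) (pl : prime l) (gl : #[g]%g = l).
Let M : {subfield E} := [aspace of fixedField [set g]].

Let memM a : (a \in M) = (g a == a).
Proof.
apply/(fixedFieldP (memvf a))/eqP => [H|H x]; first by apply: H; rewrite inE.
by rewrite inE => /eqP->.
Qed.

Let galMg : 'Gal({:E} / M)%g = <[g]>%g. Proof. exact: gal_generated. Qed.

Let dimM : \dim_M {:E} = l.
Proof. by rewrite galois_dim ?galMg // fixedField_galois. Qed.

(** The degree of [u] over [M] divides the prime [l = [E : M]] and is not 1, while the minimal
    polynomial of [u] over [M] divides [h]. *)
Let not_inM (u : E) (h : {poly k}) : u \notin M -> h != 0 ->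
  root (map_poly (in_alg E) h) u -> (l < size h)%N.
Proof.
move=> uM h0 hu.
have dvd : minPoly M u %| map_poly (in_alg E) h.
  by apply: minPoly_dvdp => //; apply: alg_polyOver.
have := dvdp_leq _ dvd; rewrite map_poly_eq0 size_map_poly size_minPoly => /(_ h0).
suff -> : adjoin_degree M u = l by [].
have : (adjoin_degree M u %| l)%N.
  rewrite adjoin_degreeE -dimM.
  have s1 := subv_adjoin M u; have s2 := subvf <<M; u>>%AS.
  rewrite -(@dvdn_pmul2r (\dim M)) ?adim_gt0 // -!dim_sup_field ?subvf //.
  exact: field_dimS.
by move/(prime_nt_dvdP pl) => ->//; rewrite adjoin_deg_eq1.
Qed.

Lemma moved_root_size (u : E) (h : {poly k}) : g u != u -> h != 0 ->
  root (map_poly (in_alg E) h) u -> (l < size h)%N.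
Proof. by rewrite -memM; apply: not_inM. Qed.

Let root_of_unity (u : E) : u ^+ l = 1 -> u \in M.
Proof.
move=> ul; have [->|u1] := eqVneq u 1; first exact: mem1v.
apply: contraT => uM; have l0 := prime_gt0 pl.
have g0 : geom l != 0 by rewrite -size_poly_gt0 geom_size.
have := not_inM uM g0; rewrite geom_size // ltnn; apply.
rewrite rootE geomE; have := subrX1 u l; rewrite ul subrr => /esym/eqP.
by rewrite mulf_eq0 subr_eq0 (negPf u1).
Qed.

(** By Hilbert 90 some nonzero [b] has [g b = b / zeta]. Then [b^l] is in [M] and has an [l]-th root
    [c] in [M]; the root of unity [b / c] is in [M] too, so [g] fixes [b], although [zeta] is not
    1. *)
Lemma no_kummer_extension (zeta : E) : root (map_poly (in_alg E) (geom l)) zeta -> l != p -> False.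
Proof.
rewrite rootE geomE => /eqP Hz lp.
have z1 : zeta != 1.
  apply/eqP => z1; move/eqP: Hz; rewrite z1.
  under eq_bigr do rewrite expr1n.
  rewrite sumr_const card_ord -(dvdn_pcharf pE) (dvdn_prime2 (pcharf_prime pE) pl) eq_sym.
  by rewrite (negPf lp).
have zl : zeta ^+ l = 1 by apply/eqP; rewrite -subr_eq0 subrX1 Hz mulr0.
have zM := root_of_unity zl.
have gen : generator 'Gal({:E} / M) g by rewrite /generator galMg.
have normz : galNorm M {:E} zeta == 1.
  rewrite /galNorm galMg (eq_bigr (fun=> zeta)) => [|x xg].
    by rewrite prodr_const -[#|_|]/#[g]%g gl zl.
  by apply: (fixed_gal (subvf M)) => //; rewrite galMg.
have /(Hilbert's_theorem_90 gen (memvf zeta)) [b [_ b0] zE] := normz.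
have z0 : zeta != 0 by apply/eqP => z0; move/eqP: zl; rewrite z0 expr0n gtn_eqF ?prime_gt0 // eq_sym oner_eq0.
have gb : g b = b / zeta.
  have gb0 : g b != 0 by rewrite fmorph_eq0.
  by rewrite zE invf_div mulrCA divff // mulr1.
have blM : b ^+ l \in M by rewrite memM rmorphXn /= gb exprMn exprVn zl invr1 mulr1.
have [c cM cE] := subfield_rad pl blM.
have c0 : c != 0 by apply/eqP => c0; move/eqP: cE; rewrite c0 expr0n gtn_eqF ?prime_gt0 // eq_sym expf_eq0 (negPf b0) andbF.
have : b / c \in M by apply: root_of_unity; rewrite exprMn exprVn cE divff // expf_neq0.
move=> bcM; have := rpredM cM bcM; rewrite mulrC divfK // memM gb => /eqP H.
case/eqP: z1; apply: (mulIf (invr_neq0 z0)); rewrite divff // mul1r.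
by apply: (mulfI b0); rewrite H mulr1.
Qed.

(** Additive Hilbert 90 by hand: an [a] of trace [T <> 0] gives [y], the sum of the [i g^i(a)], with
    [g y = y - T], and [w = - y / T] with [g w = w + 1]. Then [w^p - w] is in [M], hence equal to
    [d^p - d] with [d] in [M]. Now [u = w - d] is moved by [g] but is a root of [X^(p-1) - 1], whose
    degree is below [l = p]. *)
Lemma no_artin_schreier_extension : l = p -> False.
Proof.
move=> lp; have p0 : p%:R = 0 :> E := pcharf0 pE.
(* The indicator of the powers of [g], to which independence of automorphisms is applied to get a
   nonzero trace. *)
pose c (x : gal_of {:E}) : E := \sum_(i < l | (g ^+ i)%g == x) 1.
have l0 := prime_gt0 pl.
have c1 : c 1%g != 0.
  rewrite /c (big_pred1 (Ordinal l0)) ?oner_eq0 // => i /=.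
  rewrite -val_eqE /= -order_dvdn gl; have [->|i0] := posnP i; first by rewrite dvdn0.
  by rewrite gtnNdvd ?gtn_eqF.
have [a _] := @gal_independent_contra _ _ {:E}%AS predT c _ isT c1.
have -> : \sum_(y | predT y) c y * y a = \sum_(i < l) (g ^+ i)%g a.
  rewrite (partition_big (fun i : 'I_l => (g ^+ i)%g) predT) //=.
  apply: eq_bigr => x _; rewrite mulr_suml; apply: eq_bigr => i /eqP ->.
  by rewrite mul1r.
set T := \sum_(i < l) _ => T0.
pose f i : E := (g ^+ i)%g a.
have gf i : g (f i) = f i.+1 by rewrite /f expgSr galM ?memvf.
have fl : f l = f 0%N by rewrite /f -gl expg_order expg0.
have TE : T = \sum_(0 <= i < l) f i by rewrite big_mkord.
have gT : g T = T.
  rewrite TE rmorph_sum (eq_bigr (fun i => f i.+1)) => [|i _]; last exact: gf.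
  have : \sum_(0 <= i < l) f i + f l = f 0%N + \sum_(0 <= i < l) f i.+1.
    by rewrite -big_nat_recr // big_nat_recl.
  by rewrite fl addrC => /addrI.
pose y := \sum_(0 <= i < l) i%:R * f i.
have gy : g y = y - T.
  have -> : g y = \sum_(0 <= i < l) (i.+1%:R * f i.+1 - f i.+1).
    rewrite /y rmorph_sum; apply: eq_bigr => i _ /=.
    by rewrite rmorphM /= rmorph_nat gf -natr1 mulrDl mul1r addrK.
  rewrite sumrB.
  have E1 : \sum_(0 <= i < l) i.+1%:R * f i.+1 = y.
    have : y + l%:R * f l = 0%:R * f 0%N + \sum_(0 <= i < l) i.+1%:R * f i.+1.
      by rewrite -big_nat_recr // big_nat_recl.
    by rewrite {1}lp p0 !mul0r addr0 add0r.
  rewrite E1 -{1}gT TE rmorph_sum.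
  by congr (_ - _); apply: eq_bigr => i _; rewrite /= gf.
pose w := - (y / T).
have gw : g w = w + 1.
  by rewrite rmorphN rmorphM fmorphV /= gT gy mulrBl divff // opprB addrC.
have frob (u z : E) : (u + z) ^+ p = u ^+ p + z ^+ p.
  by have := frobeniusD pE 1 u z; rewrite expn1.
have wM : w ^+ p - w \in M.
  by rewrite memM rmorphB rmorphXn /= gw frob expr1n opprD addrACA subrr addr0.
have [d dM dE] := subfield_as wM.
have gd : g d = d by apply/eqP; rewrite -memM.
pose u := w - d.
have gu : g u = u + 1 by rewrite rmorphB /= gw gd addrAC.
have frobB (s z : E) : (s - z) ^+ p = s ^+ p - z ^+ p.
  by have := frobeniusB pE 1 s z; rewrite expn1.
have up : u ^+ p = u.
  apply/eqP; rewrite -subr_eq0 frobB; apply/eqP.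
  by move/eqP: dE; rewrite -subr_eq0 => /eqP dE; rewrite -[RHS]oppr0 -dE /u; ring.
have uM : u \notin M by rewrite memM gu -subr_eq0 addrAC subrr add0r oner_eq0.
have u0 : u != 0 by apply: contraNneq uM => ->; apply: mem0v.
have p1 : (0 < p.-1)%N by rewrite -ltnS prednK ?prime_gt1 ?prime_gt0 // (pcharf_prime pE).
have up1 : u ^+ p.-1 = 1.
  by apply: (mulfI u0); rewrite -exprS prednK ?mulr1 // (pchar_gt0 pE).
have h0 : 'X^(p.-1) - 1 != 0 :> {poly k} by rewrite -size_poly_gt0 size_XnsubC.
have := not_inM uM h0; rewrite size_XnsubC // prednK ?(pchar_gt0 pE) // lp ltnn.
move=> H; suff: false by []; apply: H.
by rewrite rmorphB rmorph1 /= map_polyXn rootE hornerD hornerN hornerXn hornerC up1 subrr.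
Qed.

End SplittingField.

(** A root outside [k] makes the Galois group nontrivial, so by Cauchy it has an element [s] of
    prime order [l], and [l <> p] by [no_artin_schreier_extension]. It moves a root of [g], and all
    factors of [g] have degree at most [n], so [l <= n]. Hence [geom l] has a root in [E], against
    [no_kummer_extension]. *)
Lemma closed_of_radicals : GRing.closed_field_axiom k.
Proof.
move=> n P n0; pose f : {poly k} := 'X^n - \poly_(i < n) P i.
have szf : size f = n.+1.
  by rewrite size_polyDl size_polyXn // size_polyN ltnS size_poly.
have f0 : f != 0 by rewrite -size_poly_gt0 szf.
suff [x fx] : exists x, root f x.
  by exists x; move: fx; rewrite rootE hornerD hornerN hornerXn horner_poly subr_eq0 => /eqP.
have geom0 l : (0 < l)%N -> geom l != 0 by move=> l0; rewrite -size_poly_gt0 geom_size.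
(* The extra factors adjoin nontrivial [l]-th roots of unity for all primes [l <= n] other than
   [p]. *)
pose g := f * \prod_(2 <= l < n.+1) geom l.
have g0 : g != 0.
  rewrite mulf_neq0 // prodf_seq_neq0; apply/allP => l; rewrite mem_index_iota => /andP[l2 _].
  by rewrite geom0 // ltnW.
have [E [zs gE genE]] := splitting_field_exists g0.
have pE : p \in [pchar E] by rewrite pchar_lalg.
have has_root h : h %| g -> (1 < size h)%N -> exists2 z, z \in zs & root (map_poly (in_alg E) h) z.
  move=> hg h1; have : map_poly (in_alg E) h %| \prod_(z <- zs) ('X - z%:P).
    by rewrite -(eqp_dvdr _ gE) dvdp_map.
  case/dvdp_prod_XsubC => m; case mE: (mask m zs) => [|z s] hE.
    by move: h1; rewrite -(size_map_poly (in_alg E)) (eqp_size hE) big_nil size_poly1.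
  exists z; first by apply: (@mem_mask _ _ m); rewrite mE mem_head.
  by rewrite (eqp_root hE) big_cons rootM root_XsubC eqxx.
have fg : f %| g by apply: dvdp_mulr.
have f1 : (1 < size f)%N by rewrite szf.
have [z zzs fz] := has_root f fg f1.
suff /vlineP [a zE] : z \in 1%VS.
  by exists a; move: fz; rewrite zE -[_%:A]/(in_alg E a) rootE horner_map fmorph_eq0.
apply: contraT => z1; have galE := radicals_galois E.
have ntG : (1 < #|'Gal({:E} / 1)%g|)%N.
  rewrite cardG_gt1; apply: contraNneq z1 => G1.
  rewrite -(galois_fixedField galE); apply/(fixedFieldP (memvf z)) => x.
  by rewrite G1 => /set1P ->; rewrite gal_id.
have pl := pdiv_prime ntG; set l := pdiv _ in pl.
have [s sG sl] := Cauchy pl (pdiv_dvd _).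
have [lp|lp] := eqVneq l p; first by case: (no_artin_schreier_extension pl sl lp).
have [y yzs sy] : exists2 y, y \in zs & s y != y.
  apply: contrapT => H; have : s = 1%g.
    apply/eqP/gal_eqP => a _; rewrite gal_id.
    have : a \in <<1 & zs>>%VS by rewrite genE memvf.
    have sub : (<<1 & zs>> <= fixedField [set s])%VS.
      apply/Fadjoin_seqP; split=> [|w wzs]; first exact: sub1v.
      apply/(fixedFieldP (memvf w)) => x; rewrite inE => /eqP ->.
      by apply/eqP; apply: contraT => sw; case: H; exists w.
    by move=> /(subvP sub) /mem_fixedFieldP [_]; apply; rewrite inE.
  by move=> s1; have := prime_gt1 pl; rewrite -sl s1 order1.
have ln : (l <= n)%N.
  have : root (map_poly (in_alg E) g) y by rewrite (eqp_root gE) root_prod_XsubC.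
  rewrite rmorphM rootM => /orP[fy|].
    by have := moved_root_size pl sl sy f0 fy; rewrite szf.
  rewrite rmorph_prod rootE horner_prod prodf_seq_eq0 /= => /hasP [j]; rewrite mem_index_iota => /andP[j2 jn].
  move=> /(moved_root_size pl sl sy (geom0 j (ltnW j2))); rewrite (geom_size (ltnW j2)) => lj.
  exact: ltnW (leq_trans lj jn).
have lg : geom l %| g.
  apply: dvdp_mull; rewrite (big_rem l) ?dvdp_mulr //=.
  by rewrite mem_index_iota prime_gt1.
have geom1 : (1 < size (geom l))%N by rewrite geom_size ?prime_gt1 // prime_gt0.
have [zeta _ Hz] := has_root _ lg geom1.
by case: (no_kummer_extension pl sl Hz lp).
Qed.

End Radicals.

(** * The residue field *)

Section UnramifiedExtension.
Context (K : fieldType) (L : fieldExtType K) (p : nat) (pL : p \in [pchar L]).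
Context (E : fieldType) (O : L -> Prop) (res : L -> E) (vO : valring O).
Hypothesis res1 : res 1 = 1.
Hypothesis resD : forall x y, O x -> O y -> res (x + y) = res x + res y.
Hypothesis resM : forall x y, O x -> O y -> res (x * y) = res x * res y.
Hypothesis res_vmax : forall x, O x -> (vmax O x <-> res x = 0).
Hypothesis nontrivial : exists x, ~ O x.
Hypothesis no_definable : ~ has_definable_valring L.
Hypothesis mult_fin : forall n, (0 < n)%N ->
  finite_index *%R (@mult_group L) (@mult_powers L n).
Hypothesis add_fin : finite_index +%R (@add_group L) (@artin_schreier_image L p).

Let res0 m : vmax O m -> res m = 0.
Proof. by move=> Mm; apply/res_vmax => //; apply: (vmax_sub vO Mm). Qed.

Let resX x n : O x -> res (x ^+ n) = res x ^+ n.
Proof.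
move=> Ox; elim: n => [|n IH]; rewrite ?expr0 // !exprS resM ?IH //.
exact: (vrX vO).
Qed.

Let perfL : forall x : L, exists y, y ^+ p = x.
Proof.
exact: finite_index_perfect pL (valring_infinite vO nontrivial) (mult_fin (pchar_gt0 pL)).
Qed.

(** For [q = p], [L] is perfect. Otherwise, were [res z] not a [q]-th power, [z] would be outside
    the group of [q]-th powers times [1 + M], and [mult_group_definable] would yield a definable
    ring. *)
Lemma residue_radical z q : prime q -> O z -> exists c, c ^+ q = res z.
Proof.
move=> pq Oz; have q0 := prime_gt0 pq.
have [->|qp] := eqVneq q p.
  have [y yz] := perfL z; exists (res y); rewrite -resX ?yz //.
  by apply: (vr_root vO (n := p.-1)); rewrite prednK ?yz // (pchar_gt0 pL).
apply: contrapT => nrad; apply: no_definable.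
have z0 : z != 0.
  apply/eqP => z0; apply: nrad; exists 0.
  by rewrite expr0n gtn_eqF // z0 res0 //; left.
pose G x := exists y m, [/\ y != 0, vmax O m & x = y ^+ q * (1 + m)].
have Gq y : y != 0 -> G (y ^+ q).
  by move=> y0; exists y, 0; split=> //; [left | rewrite addr0 mulr1].
have G1m m : vmax O m -> G (1 + m).
  by move=> Mm; exists 1, m; rewrite oner_neq0 expr1n mul1r.
have gG : mult_subgroup G.
  split=> [|x x'|x|].
  - by rewrite -(expr1n _ q); apply: Gq; rewrite oner_neq0.
  - case=> y [m [y0 Mm ->]] [y' [m' [y0' Mm' ->]]].
    exists (y * y'), (m + m' + m * m'); split; first by rewrite mulf_neq0.
      by apply: (vmaxD vO); [apply: (vmaxD vO) | apply: (vmaxMl vO) => //; apply: (vmax_sub vO)].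
    by rewrite exprMn; ring.
  - case=> y [m [y0 Mm ->]]; have [n0 nM] := vmax_1D vO Mm.
    exists y^-1, (- m / (1 + m)); rewrite invr_eq0; split=> //.
      by apply: (vmaxMr vO); [apply: vmaxN | apply: vrV].
    rewrite invfM exprVn; congr (_ * _).
    by field.
  - case=> y [m [y0 Mm /esym/eqP]]; have [n0 nM] := vmax_1D vO Mm.
    by rewrite mulf_eq0 expf_eq0 (negPf y0) andbF (negPf n0).
have [_ GM GV _] := gG.
have GX x n : G x -> G (x ^+ n).
  move=> Gx; elim: n => [|n IH]; first by rewrite expr0; case: gG.
  by rewrite exprS; apply: GM.
apply: (mult_group_definable pL vO nontrivial gG).
- exists z => // -[y [m [y0 Mm zE]]]; have [n0 nM] := vmax_1D vO Mm.
  have Oy : O y.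
    apply: (vr_root vO (n := q.-1)); rewrite prednK //.
    rewrite -[y ^+ q](mulfK n0) -zE; apply: (vrM vO) => //; exact: vrV.
  apply: nrad; exists (res y); rewrite zE resM ?resD ?resX ?res1 ?(res0 Mm) ?addr0 ?mulr1 //.
  + exact: vr1 vO.
  + exact: vmax_sub vO _ Mm.
  + exact: (vrX vO).
  + by apply: (vrD vO); [apply: vr1 | apply: (vmax_sub vO Mm)].
- move=> x Gxp; have x0 : x != 0.
    apply/eqP => x0; case: gG => _ _ _; apply.
    by move: Gxp; rewrite x0 expr0n gtn_eqF ?(pchar_gt0 pL).
  (* Since [1 + a p] is a multiple of [q], both [x^(1 + a p)] and [x^(a p)] are in [G], hence so is
     [x]. *)
  have [a _] := Bezoutl p q0.
  have -> : gcdn q p = 1%N.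
    by apply/eqP; rewrite -/(coprime q p) prime_coprime // dvdn_prime2 // (pcharf_prime pL).
  case/dvdnP => c cE; have : G (x ^+ (1 + a * p)).
    by rewrite cE exprM; apply: Gq; rewrite expf_neq0.
  have Gap : G (x ^+ (a * p)) by rewrite mulnC exprM; apply: GX.
  rewrite exprD expr1 => /GM /(_ (GV _ Gap)).
  by rewrite mulfK // expf_neq0.
- by move=> x Mx; apply: G1m; apply: vmaxN.
- exact: def1_mult_cosets gG Gq (mult_fin q0).
Qed.

(** If the equation had no solution, [z] would be outside [{y^p - y} + M]: in [z = y^p - y + m], [y]
    is in [O] and its residue solves the equation. Then [add_group_definable] applies. *)
Lemma residue_artin_schreier z : O z -> exists c, c ^+ p - c = res z.
Proof.
move=> Oz; apply: contrapT => nas; apply: no_definable.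
have p1 : (1 < p)%N := prime_gt1 (pcharf_prime pL).
pose A x := exists y m, vmax O m /\ x = y ^+ p - y + m.
have frobB (x y : L) : (x - y) ^+ p = x ^+ p - y ^+ p.
  by have := frobeniusB pL 1 x y; rewrite expn1.
have AS x : A (x ^+ p - x) by exists x, 0; split; [left | rewrite addr0].
have gA : add_subgroup A.
  split=> [|x x']; first by exists 0, 0; split; [left | rewrite expr0n gtn_eqF ?(ltnW p1) // subr0 addr0].
  case=> y [m [Mm ->]] [y' [m' [Mm' ->]]]; exists (y - y'), (m - m'); split.
    exact: vmaxB.
  by rewrite frobB; ring.
apply: (add_group_definable pL vO nontrivial perfL gA) => //.
- exists z => -[y [m [Mm zE]]].
  have OzM : O (z - m) by apply: (vrB vO) => //; apply: (vmax_sub vO Mm).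
  have yE : y ^+ p - y = z - m by rewrite zE addrK.
  have Oy : O y.
    apply: contrapT => nOy; have Mu := vmaxV nOy.
    have y0 : y != 0 by apply/eqP => y0; apply: nOy; rewrite y0; apply: vr0 vO.
    have MX n : (0 < n)%N -> vmax O (y^-1 ^+ n) by case: n => // n _; apply: vmaxX.
    (* Dividing [y^p - y = z - m] by [y^p] exhibits 1 as a sum of elements of [M]. *)
    apply: (vmax1 vO); have -> : 1 = (z - m) * y^-1 ^+ p + y^-1 ^+ p.-1.
      rewrite -yE mulrBl exprVn divff ?expf_neq0 //.
      rewrite -{1}[p](prednK (ltnW p1)) [in y / _]exprS invfM mulrA divff // mul1r.
      by rewrite exprVn subrK.
    have p'0 : (0 < p.-1)%N by rewrite -ltnS prednK // ltnW.
    by apply: (vmaxD vO); [apply: (vmaxMl vO) => // | ]; apply: MX => //; apply: ltnW.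
  have ONy : O (- y) by apply: vrN.
  have resN : res (- y) = - res y.
    apply/eqP; rewrite -addr_eq0 -resD // addNr res0 //; by left.
  have Oyp := vrX vO p Oy.
  have Om := vmax_sub vO Mm.
  apply: nas; exists (res y).
  rewrite zE resD ?resD ?resX ?resN ?(res0 Mm) ?addr0 //.
  by apply: vrD.
- by move=> x Mx; exists 0, x; split=> //; rewrite expr0n gtn_eqF ?(ltnW p1) // subr0 add0r.
- exact: def1_add_cosets gA AS add_fin.
Qed.

End UnramifiedExtension.

Theorem theorem1 (K : fieldType)
  (mult_index_finite : forall (L : fieldExtType K) (n : nat), (0 < n)%N ->
     finite_index *%R (@mult_group L) (@mult_powers L n))
  (add_index_finite : forall p : nat, p \in [pchar K] ->
     forall L : fieldExtType K,
     finite_index +%R (@add_group L) (@artin_schreier_image L p)) :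
  (exists v : valuation K, nontrivial_valuation v /\ definable (val_ring v)) \/
  (forall v : valuation K, nontrivial_valuation v ->
     divisible_value_group v /\
     ((exists p : nat, p \in [pchar K]) ->
      GRing.closed_field_axiom (residue_field v))).
Proof.
have [?|ndef] := pselect (exists v : valuation K,
  nontrivial_valuation v /\ definable (val_ring v)); [by left | right=> v ntv].
have ndefL (L : fieldExtType K) : ~ has_definable_valring L.
  by move=> /definable_valring_restrict.
split.
  apply: contrapT => ndiv; apply: (ndefL K^o).
  by apply: not_divisible_definable ndiv => n; apply: mult_index_finite.
case=> p pK; have pk : p \in [pchar residue_field v].
  have := pcharf0 pK; rewrite !inE (pcharf_prime pK) /= => pK0.
  have pA : p%:R = 0 :> val_ring_type v.
    by apply: val_inj; rewrite rmorph_nat pK0 rmorph0.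
  by rewrite -(rmorph_nat (\pi_(residue_field v))) pA rmorph0.
have [t /negP nt] : exists t, ~ t \in val_ring v by apply/existsNP.
have lift (E : fieldExtType (residue_field v)) (b : E) := unramified_lift
  (iota := (val : {rmorphism val_ring_type v -> K}))
  (pi := (\pi_(residue_field v) : {rmorphism val_ring_type v -> residue_field v}))
  val_inj (val_ring_total v) (residue_surj (v := v)) (residue_unit (v := v)) b.
have nontriv (L : fieldExtType K) (O : L -> Prop) :
    (forall s : K, (forall a : val_ring_type v, s <> val a) -> ~ O s%:A) -> exists x, ~ O x.
  by move=> H; exists t%:A; apply: H => a tE; case/negP: nt; rewrite tE; apply: valP.
apply: (closed_of_radicals pk) => E b.
  move=> q pq; have [L [O [res [vO /nontriv nO [r1 rD rM] rmax [z Oz <-]]]]] := lift E b.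
  have pL : p \in [pchar L] by rewrite pchar_lalg.
  apply: (residue_radical pL vO r1 rD rM rmax nO) => //; exact: mult_index_finite.
have [L [O [res [vO /nontriv nO [r1 rD rM] rmax [z Oz <-]]]]] := lift E b.
have pL : p \in [pchar L] by rewrite pchar_lalg.
apply: (residue_artin_schreier pL vO r1 rD rM rmax nO) => //.
  exact: mult_index_finite.
exact: add_index_finite.
Qed.
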